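(* For any $\alpha\in(1,2)$, almost surely, $T_n\ge\tau_n\ge \mathrm{e}^{\alpha^n}$ for all but finitely many $n$.
   Context: Fix $\lambda=\mu\in(0,\infty)$. Write $\mathbb{Z}_+=\{0,1,2,\ldots\}$, $\mathbb{R}_+=[0,\infty)$. $P(\kappa)$ denotes a Poisson random variable with mean $\kappa\in\mathbb{R}_+$; for a random variable $W\ge 0$, $P(W)$ denotes a random variable that, conditional on $W$, is Poisson with mean $W$. For $k\in\mathbb{Z}_+$, $\zeta(k)$ denotes a random variable distributed as the time to empty (first time with $0$ customers) of an M/M/1 queue with arrival rate and service rate both $\lambda$ started from $k$ customers; for a $\mathbb{Z}_+$-valued random variable $W$, $\zeta(W)$ is, conditional on $W$, distributed as the time to empty from $W$ customers. Let $\xi_0,\xi_1,\ldots$ be i.i.d. with $\mathbb{P}(\xi_n=\pm1)=1/2$ (tie-breakers, independent of the other random ingredients). The greedy server on $\mathbb{Z}$, observed at the successive times at which it empties a queue, is the Markov process $\Psi_n=(Q_n,X_n,T_n)$, $n\in\mathbb{Z}_+$, with $Q_n=(Q_n(x))_{x\in\mathbb{Z}}\in(\mathbb{Z}_+\cup\{*\})^{\mathbb{Z}}$, $X_n\in\mathbb{Z}$, $T_n\in\mathbb{R}_+$ (the symbol $*$ means the queue has not yet been inspected). Initially $Q_0(x)=0$ for $x\in\{-1,0,1\}$, $Q_0(x)=*$ for $|x|\ge2$, $X_0=0$, $T_0=0$. Given $(Q_n,X_n,T_n)$: - $\eta_{n+1}=+1$ if $Q_n(X_n+1)>Q_n(X_n-1)$,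 $\eta_{n+1}=-1$ if $Q_n(X_n-1)>Q_n(X_n+1)$, and $\eta_{n+1}=\xi_n$ if $Q_n(X_n+1)=Q_n(X_n-1)$; $X_{n+1}=X_n+\eta_{n+1}$. - $\tau_{n+1}$ is distributed as $1+\zeta(Q_n(X_{n+1})+P(\lambda))$; $T_{n+1}=T_n+\tau_{n+1}$. - For each $k\in\mathbb{Z}\setminus\{X_{n+1}\}$ with $Q_n(k)\ne *$, $Q_{n+1}(k)$ is distributed as $Q_n(k)+P(\lambda\tau_{n+1})$, independently for each $k$. - If $Q_n(X_{n+1}+1)=*$ then $Q_{n+1}(X_{n+1}+1)$ is distributed as $P(\lambda T_{n+1})$, and if $Q_n(X_{n+1}-1)=*$ then $Q_{n+1}(X_{n+1}-1)$ is distributed as $P(\lambda T_{n+1})$, independently; all other entries equal to $*$ remain $*$. - $Q_{n+1}(X_{n+1})=0$. *)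

(* Defs.v *)
From HB Require Import structures.
From mathcomp Require Import all_boot all_order all_algebra.
From mathcomp Require Import finmap.
From mathcomp Require Import all_classical all_reals all_analysis.
Set Implicit Arguments.
Unset Strict Implicit.
Unset Printing Implicit Defensive.
Import Order.TTheory GRing.Theory Num.Theory.
Import numFieldNormedType.Exports.
Local Open Scope classical_set_scope.
Local Open Scope ring_scope.

(* The product rule over every finite subfamily. *)
Definition mutually_independent (R : realType) d (Omega : measurableType d)
    (P : probability Omega R) (I : choiceType) (X : I -> {RV P >-> R}) : Prop :=
  forall (F : {fset I}) (B : I -> set R), (forall i, measurable (B i)) ->
    P [set w | forall i, i \in F -> B i (X i w)] =
    (\prod_(i <- F) P (X i @^-1` B i))%E.

(** M/M/1 queue, single server, first come first served: customers [0 .. k-1]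
    are present at time [0], customer [k + i] arrives at time
    [a 0 + .. + a i], and customer [j] requires service time [s j]. *)

Definition mm1_arrival (R : realType) (k : nat) (a : nat -> R) (j : nat) : R :=
  if (j < k)%N then 0 else \sum_(0 <= i < (j - k).+1) a i.

Fixpoint mm1_departure (R : realType) (k : nat) (a s : nat -> R) (j : nat) : R :=
  match j with
  | 0%N => mm1_arrival k a 0 + s 0%N
  | i.+1 => Num.max (mm1_departure k a s i) (mm1_arrival k a i.+1) + s i.+1
  end.

Definition mm1_customers (R : realType) (k : nat) (a s : nat -> R) (t : R) :
    set nat :=
  [set j | mm1_arrival k a j <= t < mm1_departure k a s j].

(* The value is [+oo] when the queue never empties. *)
Definition mm1_time_to_empty (R : realType) (k : nat) (a s : nat -> R) :
    \bar R :=
  ereal_inf [set t%:E | t in [set t | 0 <= t /\ mm1_customers k a s t = set0]].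

(* [Z] is a finite version of the time to empty: requiring it to exist also says
   that the queue empties almost surely, which holds if the arrival rate [lam]
   is at most the service rate [mu]. *)
Definition is_mm1_emptying_law (R : realType) (lam mu : R) (k : nat)
    (nu : probability R R) : Prop :=
  exists (d : measure_display) (Omega : measurableType d)
    (P : probability Omega R) (a s : nat -> {RV P >-> R}) (Z : {RV P >-> R}),
  [/\ mutually_independent
        (fun i : nat + nat => match i with inl n => a n | inr n => s n end),
      forall n B, measurable B -> distribution P (a n) B = exponential_prob lam B,
      forall n B, measurable B -> distribution P (s n) B = exponential_prob mu B,
      {ae P, forall w,
         (Z w)%:E = mm1_time_to_empty k (fun n => a n w) (fun n => s n w)} &
      forall B, measurable B -> nu B = distribution P Z B].

(** Greedy server. A queue configuration is a map [int -> option nat], with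
    [None] for the symbol [*] of a queue that has not yet been inspected. *)

(* [e = true] stands for the tie-breaker [+1], [e = false] for [-1]. The default
   value of [odflt] is irrelevant, as the queues next to the server have always
   been inspected. *)
Definition greedy_direction (q : int -> option nat) (x : int) (e : bool) : int :=
  let r := odflt 0%N (q (x + 1)) in
  let l := odflt 0%N (q (x - 1)) in
  if (l < r)%N then 1 else if (r < l)%N then -1 else if e then 1 else -1.

(* Probability that queue [k] has value [v] at the end of a step of duration [s]
   that starts at time [t] in configuration [q] and empties queue [y]. The
   measure [poisson_prob kappa _] does not depend on its second argument, and it
   is the Dirac mass at [0] for [kappa = 0] (unlike [poisson_pmf]). *)
Definition queue_pmf (R : realType) (lambda : R) (q : int -> option nat)
    (y : int) (t s : R) (k : int) (v : option nat) : \bar R :=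
  if k == y then ((v == Some 0%N)%:R)%:E
  else match q k with
  | Some m => poisson_prob (lambda * s) 0%N [set j | Some (m + j)%N = v]
  | None =>
      if (k == y + 1) || (k == y - 1)
      then poisson_prob (lambda * (t + s)) 0%N [set j | Some j = v]
      else ((v == None)%:R)%:E
  end.

(* From the state [(q, x, t)] and the tie-breaker [e], the probability that the
   duration of the step lies in [B] and that, for each [k] in [F], the new value
   of queue [k] is [v k]. The duration is [1 + z], with [z] drawn from
   [zeta (q y + j)] and [j] Poisson with mean [lambda]; given the duration, the
   new values of the queues are independent. *)
Definition greedy_transition (R : realType) (lambda : R)
    (zeta : nat -> probability R R) (q : int -> option nat) (x : int) (t : R)
    (e : bool) (B : set R) (F : {fset int}) (v : int -> option nat) : \bar R :=
  let y := x + greedy_direction q x e in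
  (\int[poisson_prob lambda 0%N]_j \int[zeta (odflt 0%N (q y) + j)%N]_z
     ((\1_B (1 + z))%:E *
      \prod_(k <- F) queue_pmf lambda q y t (1 + z)%R k (v k)))%E.

(* Generators of the sigma-algebra of the states up to [n] and of the
   tie-breakers before [n]. *)
Definition greedy_history (R : realType) d (Omega : measurableType d)
    (P : probability Omega R) (Q : nat -> Omega -> int -> option nat)
    (X : nat -> Omega -> int) (T : nat -> {RV P >-> R})
    (xi : nat -> {RV P >-> bool}) (n : nat) : set (set Omega) :=
  [set A | exists m k v, (m <= n)%N /\ A = [set w | Q m w k = v]] `|`
  [set A | exists m x, (m <= n)%N /\ A = [set w | X m w = x]] `|`
  [set A | exists m B, [/\ (m <= n)%N, measurable B & A = T m @^-1` B]] `|`
  [set A | exists m e, (m < n)%N /\ A = [set w | xi m w = e]].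

(* The field [greedy_step] gives the joint law of the tie-breaker [xi n], of
   [tau n.+1] and of finitely many coordinates of [Q n.+1], conditionally on the
   history up to [n]; the other components of the next state are functions of
   these and of the current state. The variable [tau 0] is unconstrained. *)
Record greedy_server (R : realType) (lambda : R) (zeta : nat -> probability R R)
    d (Omega : measurableType d) (P : probability Omega R)
    (Q : nat -> Omega -> int -> option nat) (X : nat -> Omega -> int)
    (T tau : nat -> {RV P >-> R}) (xi : nat -> {RV P >-> bool}) : Prop := {
  greedy_measurableQ :
    forall n k v, measurable [set w | Q n w k = v] ;
  greedy_measurableX :
    forall n x, measurable [set w | X n w = x] ;
  greedy_Q0 : forall w k, Q 0%N w k = if `|k| <= 1 then Some 0%N else None ;
  greedy_X0 : forall w, X 0%N w = 0 ;
  greedy_T0 : forall w, T 0%N w = 0 ;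
  greedy_XS : forall n w,
    X n.+1 w = X n w + greedy_direction (Q n w) (X n w) (xi n w) ;
  greedy_TS : forall n w, T n.+1 w = T n w + tau n.+1 w ;
  greedy_step : forall (n : nat) (H : set Omega) (e : bool) (B : set R)
      (F : {fset int}) (v : int -> option nat),
    <<s greedy_history Q X T xi n >> H -> measurable B ->
    P (H `&` [set w | [/\ xi n w = e, B (tau n.+1 w) &
                          forall k, k \in F -> Q n.+1 w k = v k]]) =
    (\int[P]_(w in H)
       ((2^-1)%:E *
        greedy_transition lambda zeta (Q n w) (X n w) (T n w) e B F v))%E
}.

(* Main.v *)
Require Import Defs.
From HB Require Import structures.
From mathcomp Require Import all_boot all_order all_algebra.
From mathcomp Require Import finmap.
From mathcomp Require Import all_classical all_reals all_analysis.
From mathcomp Require Import measurable_realfun.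
From mathcomp Require Import ring lra zify.
Import Order.TTheory GRing.Theory Num.Theory.
Import numFieldNormedType.Exports.
Local Open Scope classical_set_scope.
Local Open Scope ring_scope.
Set Implicit Arguments.
Unset Strict Implicit.
Unset Printing Implicit Defensive.

(** Let [kappa n] be the larger of the two queues next to the server at the end
    of step [n]; this is the queue emptied in step [n + 1]. Emptying [k]
    customers in a critical M/M/1 queue takes a time of order [k ^ 2], and a time
    below [k ^ beta] with [beta < 2] is superpolynomially unlikely. During a step
    of duration [tau], the queue that the server has just left, which was empty,
    receives about [lambda * tau] customers, and it is next to the new position.
    So [kappa n.+1] is at least [kappa n ^ beta] and [tau n.+1] is at least
    [kappa n], except on a bad step, whose conditional probability is at most
    [1 / kappa n] once [kappa n] is large ([neighbor_max_step],
    [duration_tail_min_duration]). From the small values of [kappa n], on the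
    other hand, any given level is exceeded with a probability bounded below
    ([duration_nondegenerate]), because many customers may arrive during the
    travel.

    The drift criterion [finitely_many_bad] turns these two facts into the almost
    sure finiteness of the number of bad steps, and from the last bad step on
    [kappa] dominates [expR (beta ^ m)]. Taking [beta] between [alpha] and [2]
    absorbs the unknown time of the last bad step.

    The estimate for the queue, [mm1_emptying_law_tail], is an exponential
    Chebyshev bound. If the queue started with [k] customers is empty at time [t]
    after [n] arrivals, then [k + n] services fit into [t], before the next
    arrival. The probability of this is bounded with the exponential moments of
    the services and interarrival times, and the bounds are summed over [n].
    This needs the factorization of the expectation of a product of functions of
    independent variables, [expectation_prod]. *)

(** * Integration against a measure known on sets *)

Section integral_density.
Context d d' (T : measurableType d) (S : measurableType d') (R : realType).
Variables (mu : {measure set T -> \bar R}) (rho : {measure set S -> \bar R}).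
Variables (X : T -> S) (g : T -> R).
Hypotheses (mX : measurable_fun setT X) (mg : measurable_fun setT g).
Hypotheses (g0 : forall x, 0 <= g x).
Hypothesis rhoE : forall B, measurable B ->
  (\int[mu]_(x in X @^-1` B) (g x)%:E)%E = rho B.

Import HBNNSimple.

Let integral_density_nnsfun (h : {nnsfun S >-> R}) :
  (\int[mu]_x (h (X x) * g x)%:E = \int[rho]_y (h y)%:E)%E.
Proof.
under [RHS]eq_integral do rewrite fimfunE -fsumEFin//.
rewrite [RHS]ge0_integral_fsum//; last 2 first.
  - by move=> r; exact/measurable_EFinP/measurableT_comp.
  - by move=> n x _; rewrite EFinM nnfun_muleindic_ge0.
have mpre r : measurable (X @^-1` (h @^-1` [set r])).
  by rewrite -[X in measurable X]setTI; apply: mX.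
under [LHS]eq_integral.
  move=> x _; rewrite fimfunE EFinM -fsumEFin// ge0_mule_fsuml; last first.
    by move=> r; rewrite EFinM nnfun_muleindic_ge0.
  over.
rewrite [LHS]ge0_integral_fsum//; last 2 first.
  - move=> r; apply/measurable_EFinP; apply: measurable_funM => //.
    by apply: measurable_funM => //; apply: measurableT_comp.
  - move=> n x _; rewrite EFinM mule_ge0 ?lee_fin//.
    by rewrite -lee_fin EFinM nnfun_muleindic_ge0.
apply: eq_fsbigr => r /[!inE] -[y _ <-{r}].
have hy0 : 0 <= h y by [].
rewrite integralZl_indic_nnsfun// integral_indic// setIT -rhoE//.
rewrite -ge0_integralZl//=; last 2 first.
  - exact/measurable_EFinP/measurable_funTS.
  - by move=> x _; rewrite lee_fin.
rewrite [RHS]integral_mkcond; apply: eq_integral => x _.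
rewrite patchE indicE /= -EFinM.
have -> : (x \in X @^-1` (h @^-1` [set h y])) = (X x \in h @^-1` [set h y]).
  by apply/idP/idP; rewrite !inE.
by case: ifP => _; rewrite ?mulr1// mulr0 mul0r.
Qed.

(** The agreement on sets passes to simple functions by linearity and to [f] by
    monotone convergence. It serves twice: with [X] the identity and [g] an
    exponential density, and with [X] one of several independent variables and
    [g] the product of functions of the others. *)
Lemma integral_density (f : S -> R) :
  measurable_fun setT f -> (forall y, 0 <= f y) ->
  (\int[mu]_x (f (X x) * g x)%:E = \int[rho]_y (f y)%:E)%E.
Proof.
move=> mf f0.
have mef : measurable_fun setT (EFin \o f) by exact/measurable_EFinP.
pose f_ := nnsfun_approx measurableT mef.
have f_cvg y : (f_ n y)%:E @[n --> \oo] --> (f y)%:E.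
  by apply: (@cvg_nnsfun_approx _ _ _ _ measurableT _ mef) => // z _; rewrite lee_fin.
have f_nd n m y : (n <= m)%N -> f_ n y <= f_ m y.
  by move=> nm; exact/lefP/nd_nnsfun_approx.
transitivity (limn (fun n => \int[rho]_y (f_ n y)%:E))%E; last first.
  rewrite -monotone_convergence//=.
  - by apply: eq_integral => y _; exact/cvg_lim.
  - by move=> n; exact/measurable_EFinP/measurable_funTS.
  - by move=> n y _; rewrite lee_fin.
  - by move=> y _ n m nm; rewrite lee_fin f_nd.
under [RHS]congr_lim do under eq_fun do rewrite -integral_density_nnsfun.
rewrite -monotone_convergence//=.
- apply: eq_integral => x _; apply/esym/cvg_lim => //.
  rewrite EFinM (_ : (fun n => _) = (fun n => (f_ n (X x))%:E * (g x)%:E)%E); last first.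
    by apply/funext => n; rewrite EFinM.
  by apply: cvgeZr => //; exact: f_cvg.
- move=> n; apply/measurable_EFinP; apply: measurable_funM => //.
  exact: measurableT_comp.
- by move=> n x _; rewrite lee_fin mulr_ge0.
- by move=> x _ n m nm; rewrite lee_fin ler_wpM2r// f_nd.
Qed.

End integral_density.

(** * Expectation of a product of functions of independent variables *)

Section independent_expectation.
Context (R : realType) d (Omega : measurableType d) (P : probability Omega R).
Context (I : choiceType) (X : I -> {RV P >-> R}).
Hypothesis indX : mutually_independent X.
Variables (f : I -> R -> R) (E : I -> R).
Hypotheses (mf : forall i, measurable_fun setT (f i)).
Hypotheses (f0 : forall i y, 0 <= f i y).
Hypothesis fE : forall i, (\int[P]_w (f i (X i w))%:E = (E i)%:E)%E.

Let E_ge0 i : 0 <= E i.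
Proof.
by rewrite -lee_fin -fE; apply: integral_ge0 => w _; rewrite lee_fin.
Qed.

Let mfX i : measurable_fun setT (fun w => f i (X i w)).
Proof. exact: measurableT_comp. Qed.

Let mX (i : I) (B : set R) : measurable B -> measurable (X i @^-1` B).
Proof. by move=> mB; rewrite -[X in measurable X]setTI; exact: measurable_funP. Qed.

Let measurable_event (G : {fset I}) (B : I -> set R) :
  (forall i, measurable (B i)) ->
  measurable [set w | forall i, i \in G -> B i (X i w)].
Proof.
move=> mB; rewrite (_ : [set w | _] = \bigcap_(i in [set` G]) (X i @^-1` B i))//.
by apply: fin_bigcap_measurable => // i _; exact: mX.
Qed.

(** The events in the domain of integration make the induction work: restricting
    one more variable to a set computes, by the induction hypothesis, the measure
    on the line against which the function of that variable is integrated. *)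
Let expectation_prod_event (s : seq I) (G : {fset I}) (B : I -> set R) :
  uniq s -> (forall i, i \in s -> i \notin G) -> (forall i, measurable (B i)) ->
  (\int[P]_(w in [set w | forall i, i \in G -> B i (X i w)])
      (\prod_(i <- s) f i (X i w))%:E =
   (\prod_(i <- s) E i)%:E * \prod_(i <- G) P (X i @^-1` B i))%E.
Proof.
elim: s G B => [|j s IH] G B.
  move=> _ _ mB; under eq_integral do rewrite big_nil.
  by rewrite integral_cst ?big_nil -?indX//; exact: measurable_event.
move=> /= /andP[js us] sG mB.
set D := [set w | _].
have mD : measurable D by exact: measurable_event.
have Pfin : (\prod_(i <- G) P (X i @^-1` B i))%E \is a fin_num.
  by rewrite -indX// fin_num_measure.
set p := fine (\prod_(i <- G) P (X i @^-1` B i))%E.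
have p0 : 0 <= p by apply: fine_ge0; rewrite -indX.
have c0 : 0 <= (\prod_(i <- s) E i) * p by rewrite mulr_ge0// prodr_ge0.
pose c := NngNum c0.
have mprod : measurable_fun setT (fun w => \prod_(i <- s) f i (X i w)).
  by apply: measurable_prod => i _; exact: mfX.
have prod0 w : 0 <= \prod_(i <- s) f i (X i w) by rewrite prodr_ge0.
have := @integral_density _ _ _ _ R P (mscale c (distribution P (X j)))
  (X j) (fun w => (\prod_(i <- s) f i (X i w)) * \1_D w).
move=> /(_ _ _ _ _ (f j)) dens.
rewrite big_cons EFinM -muleA -(fineK Pfin) -/p.
transitivity (\int[P]_x (f j (X j x) * (\prod_(i <- s) f i (X i x) * \1_D x))%:E)%E.
  rewrite integral_mkcond; apply: eq_integral => w _.
  by rewrite patchE indicE big_cons; case: ifP; rewrite ?mulr1 ?mulr0.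
rewrite dens//; last 3 first.
- by apply: measurable_funM => //; exact: measurable_indic.
- by move=> w; rewrite mulr_ge0.
- move=> A mA.
  pose B' i := if i == j then A else B i.
  have mB' i : measurable (B' i) by rewrite /B'; case: ifP.
  have jG : j \notin G by apply: sG; rewrite mem_head.
  have B'E : (\prod_(i <- G) P (X i @^-1` B' i) = \prod_(i <- G) P (X i @^-1` B i))%E.
    apply: eq_big_seq => i iG; rewrite /B'; case: eqP => // ij.
    by move: iG jG; rewrite ij => ->.
  transitivity (\int[P]_(w in [set w | forall i, i \in (j |` G)%fset -> B' i (X i w)])
      (\prod_(i <- s) f i (X i w))%:E)%E.
    rewrite [LHS]integral_mkcond [RHS]integral_mkcond; apply: eq_integral => w _.
    rewrite !patchE indicE.
    have -> : (w \in [set w | forall i, i \in (j |` G)%fset -> B' i (X i w)]) =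
        (w \in X j @^-1` A) && (w \in D).
      apply/idP/andP; rewrite !inE.
        move=> /= wB; split; first by have := wB j; rewrite !inE eqxx /B' eqxx; exact.
        move=> i iG; have := wB i; rewrite !inE iG orbT /B'.
        by case: eqP => [ij|_]; [rewrite -ij iG in jG | exact].
      move=> [/= wA wD] i; rewrite !inE => /orP[/eqP ->|iG]; first by rewrite /B' eqxx.
      by rewrite /B'; case: eqP => [->//|_]; exact: wD.
    by case: (w \in X j @^-1` A); case: (w \in D); rewrite ?mulr1 ?mulr0.
  rewrite IH//; last first.
    move=> i iis; rewrite !inE negb_or sG ?inE ?iis ?orbT ?andbT//.
    by apply: contra js => /eqP <-.
  rewrite big_fsetU1//= B'E /mscale/= -(fineK Pfin) -/p /B' eqxx.
  rewrite /distribution /pushforward EFinM -muleA; congr (_ * _)%E.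
  by rewrite muleC.
rewrite ge0_integral_mscale//=; last 2 first.
- exact/measurable_EFinP.
- by move=> y _; rewrite lee_fin.
rewrite ge0_integral_distribution//=; last 2 first.
- exact/measurable_EFinP.
- by move=> y; rewrite lee_fin.
by rewrite fE EFinM muleC muleA.
Qed.

(** Independence is a statement on events; it is transferred to expectations one
    factor at a time. *)
Lemma expectation_prod (s : seq I) : uniq s ->
  (\int[P]_w (\prod_(i <- s) f i (X i w))%:E = (\prod_(i <- s) E i)%:E)%E.
Proof.
move=> us; have := @expectation_prod_event s fset0 (fun=> setT) us.
rewrite big_seq_fset0 mule1 => <- //.
by congr (integral _ _ _); apply/seteqP; split.
Qed.

End independent_expectation.

(** * Exponential moments *)

Section exponential_mgf.
Context (R : realType) d (Omega : measurableType d) (P : probability Omega R).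

(** Tilting an exponential density of rate [lam] by [exp (theta * x)] gives, up to
    a constant, the exponential density of rate [lam - theta]. *)
Lemma exponential_mgf (lam theta : R) (X : {RV P >-> R}) :
  0 < lam -> theta < lam ->
  (forall B, measurable B -> distribution P X B = exponential_prob lam B) ->
  (\int[P]_w (expR (theta * X w))%:E = (lam / (lam - theta))%:E)%E.
Proof.
move=> lam0 tl XE.
have lt0 : 0 < lam - theta by rewrite subr_gt0.
have mf : measurable_fun setT (fun x : R => expR (theta * x)).
  by apply: measurableT_comp => //; apply: measurable_funM.
transitivity (\int[distribution P X]_x (expR (theta * x))%:E)%E.
  by rewrite ge0_integral_distribution//; exact/measurable_EFinP.
transitivity (\int[@lebesgue_measure R]_x
    (expR (theta * x) * exponential_pdf lam x)%:E)%E.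
  apply/esym; apply: (@integral_density _ _ _ _ R lebesgue_measure
    (distribution P X) id (exponential_pdf lam)) => //.
  - exact: measurable_exponential_pdf.
  - by move=> x; apply: exponential_pdf_ge0; exact: ltW.
  - by move=> B mB; exact/esym/XE.
transitivity (\int[@lebesgue_measure R]_x ((lam / (lam - theta))%:E *
    (exponential_pdf (lam - theta) x)%:E))%E.
  apply: eq_integral => x _; rewrite -EFinM; congr EFin.
  have [x0|x0] := leP 0 x; last by rewrite !lt0_exponential_pdf// !mulr0.
  rewrite !exponential_pdfE// mulrCA -expRD.
  rewrite (_ : theta * x + - lam * x = - (lam - theta) * x); last by ring.
  by rewrite mulrA divfK ?gt_eqF.
rewrite ge0_integralZl//; last 3 first.
- by apply: measurableT_comp => //; exact: measurable_exponential_pdf.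
- by move=> x _; rewrite lee_fin exponential_pdf_ge0// ltW.
- by rewrite lee_fin divr_ge0// ltW.
by rewrite integral_exponential_pdf// mule1.
Qed.

End exponential_mgf.

(** * Time to empty an M/M/1 queue *)

Section mm1_path.
Context (R : realType) (k : nat) (a s : nat -> R).
Hypothesis k_gt0 : (0 < k)%N.

Lemma mm1_departure_ge_service j :
  \sum_(0 <= i < j.+1) s i <= mm1_departure k a s j.
Proof.
elim: j => [|j IH] /=.
  by rewrite big_nat1 /mm1_arrival k_gt0 add0r.
by rewrite big_nat_recr//= lerD2r (le_trans IH)// le_max lexx.
Qed.

(** If the queue is empty at time [t] and exactly [n] customers arrived by then,
    the first [k + n] customers have been served, one after the other, before
    [t], and customer [k + n] has not arrived. The second alternative covers the
    case of at least [N] arrivals. *)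
Lemma mm1_empty_service t N : 0 <= t -> mm1_customers k a s t = set0 ->
  (exists2 n, (n < N)%N &
     \sum_(0 <= i < k + n) s i <= t < \sum_(0 <= i < n.+1) a i) \/
  \sum_(0 <= i < k + N) s i <= t.
Proof.
move=> t0 empty.
have left j : mm1_arrival k a j <= t -> \sum_(0 <= i < j.+1) s i <= t.
  move=> aj; apply: le_trans (mm1_departure_ge_service j) _.
  rewrite leNgt; apply/negP => tj.
  suff : mm1_customers k a s t j by rewrite empty.
  by rewrite /mm1_customers /= aj.
elim: N => [|N [[n nN nP]|IH]].
- right; rewrite addn0 -(prednK k_gt0); apply: left.
  by rewrite /mm1_arrival prednK// leqnn.
- by left; exists n => //; rewrite ltnS ltnW.
- have [tN|Nt] := ltP t (\sum_(0 <= i < N.+1) a i).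
    by left; exists N => //; rewrite IH tN.
  right; rewrite addnS; apply: left.
  by rewrite /mm1_arrival ltnNge leq_addr/= addKn.
Qed.

Lemma mm1_time_to_empty_lt s0 N : (mm1_time_to_empty k a s < s0%:E)%E ->
  (exists2 n, (n < N)%N & \sum_(0 <= i < k + n) s i < s0 /\
     \sum_(0 <= i < k + n) s i < \sum_(0 <= i < n.+1) a i) \/
  \sum_(0 <= i < k + N) s i < s0.
Proof.
move=> /ereal_inf_lt [_ [t [t0 empty] <-]]; rewrite lte_fin => ts.
have [[n nN /andP[St tA]]|St] := @mm1_empty_service t N t0 empty.
  by left; exists n => //; split; [apply: le_lt_trans ts|apply: le_lt_trans tA].
by right; apply: le_lt_trans ts.
Qed.

End mm1_path.

Lemma mm1_time_to_empty_ge0 (R : realType) (k : nat) (a s : nat -> R) :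
  (0 <= mm1_time_to_empty k a s)%E.
Proof. by apply: le_ereal_inf_tmp => _ [t [t0 _] <-]; rewrite lee_fin. Qed.

Section mm1_tail.
Context (R : realType) (lam : R) (lam_gt0 : 0 < lam).
Context d (Omega : measurableType d) (P : probability Omega R).
Variables (a s : nat -> {RV P >-> R}).
Hypothesis indep : mutually_independent
  (fun i : nat + nat => match i with inl n => a n | inr n => s n end).
Hypothesis aE : forall n B, measurable B ->
  distribution P (a n) B = exponential_prob lam B.
Hypothesis sE : forall n B, measurable B ->
  distribution P (s n) B = exponential_prob lam B.

Let excess (c x y : R) (n m : nat) : Omega -> R := fun w =>
  c + x * (\sum_(0 <= i < n) a i w) - y * (\sum_(0 <= i < m) s i w).

Let measurable_excess c x y n m : measurable_fun setT (excess c x y n m).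
Proof.
apply: measurable_funB; last first.
  by apply: measurable_funM => //; apply: measurable_sum => i; exact: measurable_funP.
apply: measurable_funD => //.
by apply: measurable_funM => //; apply: measurable_sum => i; exact: measurable_funP.
Qed.

Let measurable_excess_ge0 c x y n m :
  measurable [set w | 0 <= excess c x y n m w].
Proof.
rewrite (_ : [set w | _] = excess c x y n m @^-1` `[0, +oo[); last first.
  by apply/seteqP; split => w /=; rewrite in_itv/= andbT.
by rewrite -[X in measurable X]setTI; apply: measurable_excess.
Qed.

(** Markov's inequality for the exponential of [excess]. *)
Let chernoff (c x y : R) (n m : nat) : x < lam -> 0 <= y ->
  (P [set w | (0 <= excess c x y n m w)%R] <=
   (expR c * (lam / (lam - x)) ^+ n * (lam / (lam + y)) ^+ m)%:E)%E.
Proof.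
move=> xlam y0.
pose X (i : nat + nat) : {RV P >-> R} :=
  match i with inl n => a n | inr n => s n end.
pose th (i : nat + nat) := if i is inl _ then x else - y.
pose f i (z : R) := expR (th i * z).
pose E (i : nat + nat) := lam / (lam - th i).
pose r : seq (nat + nat) := [seq inl i | i <- index_iota 0 n] ++ [seq inr i | i <- index_iota 0 m].
have thlam i : th i < lam.
  by case: i => i //=; rewrite (le_lt_trans _ lam_gt0)// oppr_le0.
have mf i : measurable_fun setT (f i).
  by apply: measurableT_comp => //; apply: measurable_funM.
have f0 i z : 0 <= f i z by exact: expR_ge0.
have fE i : (\int[P]_w (f i (X i w))%:E = (E i)%:E)%E.
  by apply: exponential_mgf => //; case: i => i; [exact: aE|exact: sE].
have ur : uniq r.
  rewrite cat_uniq !map_inj_uniq ?iota_uniq//= ?andbT; last 2 first.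
  - by move=> i j [].
  - by move=> i j [].
  by apply/hasPn => _ /mapP[i _ ->]; apply/negP => /mapP[].
have prodE w : expR (excess c x y n m w) = expR c * \prod_(i <- r) f i (X i w).
  rewrite big_cat/= !big_map/= -!expR_sum -!mulr_sumr -!expRD.
  by congr expR; rewrite /excess mulNr addrA.
have := expectation_prod indep mf f0 fE ur.
rewrite big_cat/= !big_map/E /= opprK !prodr_const_nat !subn0 => prodr.
rewrite -mulrA EFinM -prodr -ge0_integralZl//=; last 2 first.
- by apply/measurable_EFinP/measurable_prod => i _; exact: measurableT_comp.
- by move=> w _; rewrite lee_fin prodr_ge0.
have := measurable_excess_ge0 c x y n m.
set A := [set w | _] => mA.
have -> : P A = (\int[P]_w (\1_A w)%:E)%E by rewrite integral_indic// setIT.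
apply: ge0_le_integral => //=.
- exact/measurable_EFinP/measurable_indic.
- apply/measurable_EFinP; apply: measurable_funM => //.
  by apply: measurable_prod => i _; exact: measurableT_comp.
- move=> w _; rewrite -EFinM -prodE lee_fin indicE.
  case: (boolP (w \in A)) => [|_]; last exact: expR_ge0.
  by rewrite inE/= => wA; rewrite -expR0 ler_expR.
Qed.

Let early_service_le s0 k N :
  (P [set w | (0 <= excess (lam * s0) 0 lam 0 (k + N) w)%R] <=
   (expR (lam * s0) * 2^-1 ^+ N)%:E)%E.
Proof.
apply: le_trans (chernoff _ _ _ lam_gt0 (ltW lam_gt0)) _.
rewrite lee_fin expr0 mulr1 ler_wpM2l ?expR_ge0//.
have -> : lam / (lam + lam) = 2^-1 :> R by field; rewrite gt_eqF// addr_gt0.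
rewrite ler_wiXn2l ?leq_addl//; lra.
Qed.

(** The event contains the one that [k + n] services end before [s0] and before
    arrival [n]. Comparing arrivals with services alone, with the tilt [lam * u],
    would give bounds that grow like [(1 - u ^+ 2) ^- n]. Tilting the services by
    a further [4 * lam * u ^+ 2] turns this into a geometric decay in [n], at the
    price of the factor [expR (4 * u ^+ 2 * lam * s0)]. *)
Let overtake_le s0 u k n : 0 < u -> u <= 2^-1 ->
  (P [set w | (0 <= excess (lam * (4 * u ^+ 2) * s0) (lam * u)
        (lam * (u + 4 * u ^+ 2)) n.+1 (k + n) w)%R] <=
   (expR (4 * u ^+ 2 * lam * s0) * 2 * (1 + u) ^- k *
      (1 + u ^+ 2) ^- n)%:E)%E.
Proof.
move=> u0 u2.
have lu : lam * u < lam by rewrite gtr_pMr//; lra.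
have lv : 0 <= lam * (u + 4 * u ^+ 2).
  by rewrite mulr_ge0 ?(ltW lam_gt0)// addr_ge0 ?(ltW u0)// mulr_ge0// sqr_ge0.
apply: le_trans (chernoff _ _ _ lu lv) _.
have -> : lam * (4 * u ^+ 2) * s0 = 4 * u ^+ 2 * lam * s0 by ring.
have -> : lam / (lam - lam * u) = (1 - u)^-1.
  by field; apply/andP; split; apply/eqP; nra.
have -> : lam / (lam + lam * (u + 4 * u ^+ 2)) = (1 + u + 4 * u ^+ 2)^-1.
  by field; apply/andP; split; apply/eqP; nra.
rewrite lee_fin (exprS _ n) exprD -!mulrA ler_wpM2l ?expR_ge0//.
rewrite [leLHS](_ : _ = (1 - u)^-1 * ((1 + u + 4 * u ^+ 2)^-1 ^+ k *
   ((1 - u)^-1 * (1 + u + 4 * u ^+ 2)^-1) ^+ n)); last first.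
  by rewrite exprMn (mulrCA ((1 + u + _)^-1 ^+ k)).
have u1 : 0 < 1 - u by lra.
have v0 : 0 < 1 + u + 4 * u ^+ 2 by nra.
apply: ler_pM.
- by rewrite invr_ge0 ltW.
- by rewrite mulr_ge0// exprn_ge0// ?mulr_ge0// invr_ge0 ltW.
- by rewrite invf_ple ?posrE//; lra.
rewrite -!exprVn; apply: ler_pM.
- by rewrite exprn_ge0// invr_ge0 ltW.
- by rewrite exprn_ge0// mulr_ge0// invr_ge0 ltW.
- by rewrite lerXn2r ?nnegrE ?invr_ge0 ?(ltW v0)//; [lra|rewrite lef_pV2 ?posrE//; nra].
- rewrite lerXn2r ?nnegrE ?mulr_ge0 ?invr_ge0 ?(ltW v0) ?(ltW u1)//; first nra.
  by rewrite -invfM lef_pV2 ?posrE ?mulr_gt0//; nra.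
Qed.

(** Union bound over the number of arrivals before the queue empties. With [u] of
    order [s0 ^ (- 1/2)] the bound is exponentially small as soon as [k] is much
    larger than [s0 ^ (1/2)]: emptying [k] customers takes a time of order
    [k ^ 2] at least. *)
Lemma mm1_emptying_tail (k : nat) (Z : {RV P >-> R}) (u s0 : R) :
  (0 < k)%N -> 0 < u -> u <= 2^-1 ->
  {ae P, forall w,
     (Z w)%:E = mm1_time_to_empty k (fun n => a n w) (fun n => s n w)} ->
  (P (Z @^-1` `]-oo, s0[) <=
   (expR (4 * u ^+ 2 * lam * s0) * (4 / u ^+ 2) * (1 + u) ^- k)%:E)%E.
Proof.
move=> k0 u0 u2 [N0 [mN0 PN0 subN0]].
set G := _ * _ * _.
pose C := expR (4 * u ^+ 2 * lam * s0) * 2 * (1 + u) ^- k.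
have C0 : 0 <= C.
  by rewrite mulr_ge0 ?mulr_ge0 ?expR_ge0// invr_ge0 exprn_ge0//; lra.
pose q := (1 + u ^+ 2)^-1.
have u2_gt0 : 0 < u ^+ 2 by rewrite exprn_gt0.
have q0 : 0 <= q by rewrite invr_ge0; lra.
have q1 : q < 1 by rewrite invf_lt1; lra.
have geom N : \sum_(n < N) C * q ^+ n <= G.
  rewrite -mulr_sumr.
  have sumq : \sum_(n < N) q ^+ n = (1 - q ^+ N) / (1 - q).
    have := subrX1 q N => /(congr1 -%R); rewrite -mulNr !opprB => ->.
    by rewrite mulrC mulKf// gt_eqF// subr_gt0.
  have : (1 - q ^+ N) / (1 - q) <= 2 / u ^+ 2.
    have -> : 1 - q = u ^+ 2 / (1 + u ^+ 2).
      by rewrite /q; field; apply/eqP; lra.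
    rewrite invf_div mulrA ler_pM2r ?invr_gt0//.
    have qN : 0 <= q ^+ N by rewrite exprn_ge0.
    have : u ^+ 2 <= 1 by nra.
    nra.
  rewrite sumq => /(ler_wpM2l C0) /le_trans; apply.
  rewrite /C /G; move: ((1 + u) ^- k) (expR _) => w e.
  by rewrite le_eqVlt; apply/orP; left; apply/eqP; field; rewrite gt_eqF.
have bound N : (P (Z @^-1` `]-oo, s0[) <= (G + expR (lam * s0) * 2^-1 ^+ N)%:E)%E.
  pose E n := [set w | 0 <= excess (lam * (4 * u ^+ 2) * s0) (lam * u)
        (lam * (u + 4 * u ^+ 2)) n.+1 (k + n) w].
  pose F := [set w | 0 <= excess (lam * s0) 0 lam 0 (k + N) w].
  have mE n : measurable (E n) by exact: measurable_excess_ge0.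
  have mF : measurable F by exact: measurable_excess_ge0.
  have mU : measurable (\big[setU/set0]_(n < N) E n) by exact: bigsetU_measurable.
  have sub : Z @^-1` `]-oo, s0[ `<=` (\big[setU/set0]_(n < N) E n `|` F) `|` N0.
    move=> w /=; rewrite in_itv/= => Zs.
    have [wN|/contrapT ZE] := pselect (~ ((Z w)%:E =
        mm1_time_to_empty k (fun n => a n w) (fun n => s n w))).
      by right; exact: subN0.
    left; rewrite -lte_fin ZE in Zs.
    have [[n nN [Ss SA]]|Ss] := mm1_time_to_empty_lt k0 N Zs.
      left; rewrite -bigcup_mkord; exists n => //; rewrite /E /= /excess.
      have : 0 <= lam * (4 * u ^+ 2) * (s0 - \sum_(0 <= i < k + n) s i w).
        apply: mulr_ge0; last by rewrite subr_ge0 ltW.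
        by rewrite mulr_ge0 ?(ltW lam_gt0)// mulr_ge0// sqr_ge0.
      have : 0 <= lam * u * (\sum_(0 <= i < n.+1) a i w - \sum_(0 <= i < k + n) s i w).
        apply: mulr_ge0; last by rewrite subr_ge0 ltW.
        by rewrite mulr_ge0// ltW.
      lra.
    right; rewrite /F /= /excess mul0r addr0 -mulrBr.
    by rewrite mulr_ge0 ?(ltW lam_gt0)// subr_ge0 ltW.
  apply: le_trans (le_measure P _ _ sub) _; rewrite ?inE//.
  - by rewrite -[X in measurable X]setTI; exact: measurable_funP.
  - by do 2 apply: measurableU => //.
  apply: le_trans (measureU2 _ _ _) _ => //; first exact: measurableU.
  rewrite [X in (_ + X <= _)%E]PN0 adde0.
  apply: le_trans (measureU2 _ _ _) _ => //.
  rewrite EFinD leeD//; last exact: early_service_le.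
  apply: le_trans (Boole_inequality _ _) _ => //.
  rewrite (@le_trans _ _ (\sum_(n < N) (C * q ^+ n)%:E)%E)//.
    by apply: lee_sum => n _; rewrite /q exprVn; exact: overtake_le.
  by rewrite sumEFin lee_fin.
apply/lee_addgt0Pr => e e0.
have : (expR (lam * s0) * 2^-1 ^+ N) @[N --> \oo] --> (0 : R).
  rewrite -[X in _ --> X](mulr0 (expR (lam * s0))).
  apply: cvgMr; apply: cvg_expr; rewrite ger0_norm; lra.
move=> /cvgrPdist_le /(_ _ e0) [N _ /(_ N (leqnn N))].
rewrite sub0r normrN => eN; apply: le_trans (bound N) _.
rewrite -EFinD lee_fin lerD2l; apply: le_trans eN; exact: ler_norm.
Qed.

End mm1_tail.

Lemma mm1_emptying_law_tail (R : realType) (lam : R) (k : nat)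
    (nu : probability R R) (u s0 : R) :
  0 < lam -> is_mm1_emptying_law lam lam k nu ->
  (0 < k)%N -> 0 < u -> u <= 2^-1 ->
  (nu `]-oo, s0[%classic <=
   (expR (4 * u ^+ 2 * lam * s0) * (4 / u ^+ 2) * (1 + u) ^- k)%:E)%E.
Proof.
move=> lam0 [disp [Om [Pr [a [s [Z [ind aE sE ZE nuE]]]]]]] k0 u0 u2.
by rewrite nuE//; exact: (mm1_emptying_tail lam0 ind aE sE s0 k0 u0 u2 ZE).
Qed.

Lemma mm1_emptying_law_ge0 (R : realType) (lam : R) (k : nat)
    (nu : probability R R) :
  is_mm1_emptying_law lam lam k nu -> nu `]-oo, 0[%classic = 0%E.
Proof.
move=> [disp [Om [Pr [a [s [Z [_ _ _ [N0 [mN0 PN0 subN0]] nuE]]]]]]].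
rewrite nuE//; apply: (@subset_measure0 _ _ _ Pr _ N0) => //.
  by rewrite -[X in measurable X]setTI; exact: measurable_funP.
move=> w /=; rewrite in_itv/= => Z0; apply: subN0 => /= ZE.
by move: Z0; rewrite -lte_fin ZE ltNge mm1_time_to_empty_ge0.
Qed.

(** * A drift criterion for finitely many bad steps *)

Section countable_fibers.
Context d (Omega : measurableType d) (R : realType) (P : probability Omega R).

(** This replaces conditioning on a discrete variable. *)
Lemma le_measure_fibers (J : countType) (X : Omega -> J) (A B : set Omega) (c : R) :
  (forall x, measurable [set w | X w = x]) -> measurable A -> measurable B ->
  0 <= c ->
  (forall x, (P (A `&` [set w | X w = x]) <= c%:E * P (B `&` [set w | X w = x]))%E) ->
  (P A <= c%:E * P B)%E.
Proof.
move=> mX mA mB c0 XAB.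
pose F n := [set w | choice.pickle (X w) = n].
have FE n : (exists x, F n = [set w | X w = x]) \/ F n = set0.
  have [[w /= wn]|/forallNP noF] := pselect (exists w, choice.pickle (X w) = n); last first.
    by right; apply/seteqP; split => w //= /noF.
  left; exists (X w); apply/seteqP; split => w' /=; last by rewrite /F /= => ->.
  by rewrite /F /= -wn => /(pcan_inj choice.pickleK).
have mF n : measurable (F n) by have [[x ->]|->] := FE n.
have tF : trivIset setT F.
  apply/trivIsetP => i j _ _ ij; apply/seteqP; split => // w /= [Fi Fj];
    by move: ij; rewrite -Fi -Fj eqxx.
have sumF C : measurable C -> P C = (\sum_(n <oo) P (C `&` F n))%E.
  move=> mC; have := @measure_bigcup _ _ _ P setT (fun n => C `&` F n).
  rewrite -setI_bigcupr (_ : \bigcup_n F n = setT) ?setIT; last first.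
    by apply/seteqP; split => // w _; exists (choice.pickle (X w)).
  move=> -> //; last 2 first.
  - by move=> n _; exact: measurableI.
  - exact: trivIset_setIl.
  by apply: eq_eseriesl => n; rewrite in_setT.
rewrite (sumF A)// (sumF B)// -nneseriesZl//.
apply: lee_nneseries => // n _.
by have [[x ->]|->] := FE n; rewrite ?setI0 ?measure0 ?mule0.
Qed.

End countable_fibers.

Section bounded_drift.
Context d (Omega : measurableType d) (R : realType) (P : probability Omega R).
Variables (kappa : nat -> Omega -> nat) (bad : nat -> set Omega).
Variables (M : nat) (delta : R).
Hypotheses (M_ge4 : (4 <= M)%N) (delta_gt0 : 0 < delta).
Hypothesis mkappa : forall n k, measurable [set w | kappa n w = k].
Hypothesis mbad : forall n, measurable (bad n).
Hypothesis bad_low : forall n k, (k < M)%N ->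
  (P ([set w | kappa n w = k] `&` bad n) <=
   (1 - delta)%:E * P [set w | kappa n w = k])%E.
Hypothesis bad_high : forall n k, (M <= k)%N ->
  (P ([set w | kappa n w = k] `&` bad n) <=
   (k%:R^-1)%:E * P [set w | kappa n w = k])%E.
Hypothesis good_grows : forall n w, ~ bad n w ->
  (M <= kappa n.+1 w)%N /\ (2 * kappa n w <= kappa n.+1 w)%N.

Let c : R := delta^-1.
Let A : R := 4 * (1 + c).
Let hmax : R := c + A / M%:R.
Let h (k : nat) : R := if (k < M)%N then hmax else A / k%:R.

Let c_gt0 : 0 < c. Proof. by rewrite invr_gt0. Qed.
Let A_gt0 : 0 < A. Proof. by rewrite /A; have := c_gt0; lra. Qed.
Let M_gt0 : 0 < M%:R :> R. Proof. by rewrite ltr0n; lia. Qed.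

Let h_ge0 k : 0 <= h k.
Proof.
rewrite /h; case: ifP => _; last by rewrite divr_ge0// ltW// A_gt0.
by rewrite addr_ge0// ?divr_ge0// ltW.
Qed.

Let h_anti m k : (M <= m)%N -> (m <= k)%N -> h k <= A / m%:R.
Proof.
move=> Mm mk; rewrite /h ltnNge (leq_trans Mm mk)/= ler_pM2l//.
have m0 : 0 < m%:R :> R by rewrite ltr0n; lia.
by rewrite lef_pV2 ?posrE ?ler_nat ?ltr0n//; lia.
Qed.

Let h_le k : h k <= hmax.
Proof.
have [kM|Mk] := ltnP k M; first by rewrite /h kM.
by rewrite (le_trans (h_anti (leqnn M) Mk))// lerDr ltW.
Qed.

Let measurable_h n : measurable_fun setT (fun w => h (kappa n w)).
Proof.
apply: (@measurableT_comp _ _ _ _ _ _ h); first by [].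
move=> _ Y _; rewrite setTI.
rewrite (_ : _ @^-1` Y = \bigcup_(k in Y) [set w | kappa n w = k]).
  by apply: bigcup_measurable => k _; exact: mkappa.
apply/seteqP; split => w /=; first by move=> Yw; exists (kappa n w).
by case=> k Yk /= ->.
Qed.

Let V n := (\int[P]_w (h (kappa n w))%:E)%E.

(* On a bad step [h] is at most [hmax]; on a good one it is at most [A / M], and
   at most half of [A / k] from a level [k >= M], where the other half pays for
   the bad steps since [1 + hmax <= A / 2]. *)
Let V_step n : (V n.+1 + P (bad n) <= V n)%E.
Proof.
pose F k := [set w | kappa n w = k].
pose G w := h (kappa n.+1 w) + \1_(bad n) w.
have mG : measurable_fun setT G.
  by apply: measurable_funD; [exact: measurable_h|exact: measurable_indic].
have G0 w : 0 <= G w by rewrite addr_ge0.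
have tF : trivIset setT F.
  by apply/trivIsetP => i j _ _ ij; apply/seteqP; split => // w /= [Fi Fj];
    by move: ij; rewrite -Fi -Fj eqxx.
have UF : \bigcup_k F k = setT.
  by apply/seteqP; split => // w _; exists (kappa n w).
have -> : (V n.+1 + P (bad n) = \int[P]_w (G w)%:E)%E.
  under eq_integral do rewrite EFinD.
  rewrite ge0_integralD//=; last 3 first.
  - by move=> w _; rewrite lee_fin.
  - exact/measurable_EFinP/measurable_h.
  - exact/measurable_EFinP/measurable_indic.
  by rewrite integral_indic// setIT.
rewrite /V -UF !ge0_integral_bigcup//; last 6 first.
- by move=> k; exact: mkappa.
- by rewrite UF; exact/measurable_EFinP/measurable_h.
- by move=> w _; rewrite lee_fin.
- by move=> k; exact: mkappa.
- by rewrite UF; exact/measurable_EFinP.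
- by move=> w _; rewrite lee_fin.
apply: lee_nneseries => [k _ _|k _].
  by apply: integral_ge0 => w _; rewrite lee_fin.
have -> : (\int[P]_(w in F k) (h (kappa n w))%:E = (h k)%:E * P (F k))%E.
  rewrite -integral_cst; last exact: mkappa.
  apply: eq_integral => w; rewrite inE => /= Fw.
  by rewrite Fw.
have key (r b g : R) : 0 <= r -> 0 <= b ->
    (forall w, F k w -> G w <= r + b * \1_(bad n) w) ->
    (P (F k `&` bad n) <= g%:E * P (F k))%E -> r + b * g <= h k ->
    (\int[P]_(w in F k) (G w)%:E <= (h k)%:E * P (F k))%E.
  move=> r0 b0 Gle gP rbg.
  have mFk : measurable (F k) by exact: mkappa.
  apply: (@le_trans _ _ (\int[P]_(w in F k) (r + b * \1_(bad n) w)%:E)%E).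
    apply: ge0_le_integral => //=.
    - by move=> w _; rewrite lee_fin.
    - by apply/measurable_EFinP/measurable_funTS.
    - apply/measurable_EFinP/measurable_funTS; apply: measurable_funD => //.
      by apply: measurable_funM => //; exact: measurable_indic.
  under eq_integral do rewrite EFinD EFinM.
  rewrite ge0_integralD//=; last 2 first.
  - by move=> w _; rewrite mule_ge0// lee_fin.
  - apply: emeasurable_funM => //.
    exact/measurable_EFinP/measurable_funTS/measurable_indic.
  rewrite integral_cst// ge0_integralZl//=; last first.
    exact/measurable_EFinP/measurable_funTS/measurable_indic.
  rewrite integral_indic// setIC.
  apply: (@le_trans _ _ (r%:E * P (F k) + b%:E * (g%:E * P (F k)))%E).
    by rewrite leeD2l// lee_wpmul2l// lee_fin.
  rewrite muleA -EFinM -(fineK (fin_num_measure P _ mFk)) -!EFinM -EFinD lee_fin.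
  by rewrite -mulrDl ler_wpM2r// fine_ge0.
have [kM|Mk] := ltnP k M.
  apply: (key (A / M%:R) (1 + c) (1 - delta)).
  - by rewrite divr_ge0// ltW// A_gt0.
  - by rewrite addr_ge0// ltW.
  - move=> w Fw; rewrite /G indicE; have [wb|/negP wg] := boolP (w \in bad n).
      by rewrite mulr1n mulr1; have := h_le (kappa n.+1 w); rewrite /hmax; lra.
    have [|kg _] := @good_grows n w; first by rewrite inE in wg.
    by rewrite mulr0 !addr0; exact: h_anti.
  - exact: bad_low.
  - have cd : c * delta = 1 by rewrite /c mulVf ?gt_eqF.
    rewrite /h kM /hmax; move: (A / _) => r.
    rewrite mulrBr mulr1 mulrDl mul1r cd.
    by have := ltW delta_gt0; move: c delta => y z; lra.
apply: (key (A / (2 * k)%:R) (1 + hmax) k%:R^-1).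
- by rewrite divr_ge0// ltW// A_gt0.
- by rewrite !addr_ge0 ?divr_ge0// ltW// A_gt0.
- move=> w Fw; rewrite /G indicE; have [wb|/negP wg] := boolP (w \in bad n).
    have := h_le (kappa n.+1 w).
    have : 0 <= A / (2 * k)%:R by rewrite divr_ge0// ltW// A_gt0.
    by rewrite mulr1n mulr1; lra.
  have [|kg k2] := @good_grows n w; first by rewrite inE in wg.
  rewrite mulr0 !addr0; apply: h_anti; first by lia.
  by rewrite -[k]Fw.
- exact: bad_high.
- rewrite /h ltnNge Mk/= natrM invfM mulrA -mulrDl ler_pM2r; last first.
    by rewrite invr_gt0 ltr0n; lia.
  have : A / M%:R <= 1 + c.
    rewrite ler_pdivrMr// /A mulrC ler_pM2l; first by rewrite (ler_nat _ 4).
    by rewrite addr_gt0.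
  by rewrite /hmax /A; lra.
Qed.

(** The function [h] is of order [1 / k] for large [k], so that it halves when
    [k] doubles. This makes up for a probability [1 / k] of a bad step, and the
    jump of size [c = 1 / delta] at [M] makes up for the bad steps below [M].
    Hence the expected number of bad steps is at most the supremum of [h], and
    the Borel-Cantelli lemma applies. *)
Lemma finitely_many_bad : {ae P, forall w, \forall n \near \oo, ~ bad n w}.
Proof.
have V0 n : (0 <= V n)%E by apply: integral_ge0 => w _; rewrite lee_fin.
have Vsum N : (\sum_(0 <= n < N) P (bad n) + V N <= V 0)%E.
  elim: N => [|N IH]; first by rewrite big_nil add0e.
  by rewrite big_nat_recr//= -addeA (addeC (P _)) (le_trans _ IH)// leeD2l.
have V0fin : (V 0 < +oo)%E.
  apply: (@le_lt_trans _ _ (\int[P]_w (hmax%:E))%E).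
    apply: ge0_le_integral => //=.
    - by move=> w _; rewrite lee_fin.
    - exact/measurable_EFinP/measurable_h.
    - by move=> w _; rewrite lee_fin.
  rewrite integral_cst// [X in (_ * X)%E](_ : _ = 1%E) ?mule1 ?ltry//.
  exact: probability_setT.
exists (lim_sup_set bad); split.
- by apply: bigcap_measurable => // n _; apply: bigcup_measurable.
- apply: lim_sup_set_cvg0 => //; apply: le_lt_trans V0fin.
  apply: lime_le; first exact: is_cvg_nneseries.
  apply: nearW => N; apply: le_trans (Vsum N).
  by rewrite leeDl.
- move=> w /= nw n _; apply: contrapT => nobad; apply: nw.
  by exists n => // j /= nj bj; apply: nobad; exists j.
Qed.

End bounded_drift.

(** * The transition kernel of the greedy server *)

Lemma measurable_lt_set (R : realType) (s : R) : measurable [set r : R | r < s].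
Proof.
by rewrite (_ : [set r | _] = `]-oo, s[%classic).
Qed.

(** One term of the series of [expR (x / 2)]. *)
Lemma poisson_pmf_le (R : realType) (x : R) (i : nat) : 0 < x ->
  poisson_pmf x i <= expR (- (x / 2)) * 2 ^+ i.
Proof.
move=> x0; rewrite /poisson_pmf x0.
have x20 : 0 <= x / 2 by lra.
have e_ge : (x / 2) ^+ i / i`!%:R <= expR (x / 2).
  case: i => [|i]; first by rewrite expr0 fact0 divr1 (le_trans _ (expR_ge1Dx _))// lerDl.
  by apply: le_trans (expR_ge1Dxn i x20); rewrite lerDr.
have -> : x ^+ i / i`!%:R = 2 ^+ i * ((x / 2) ^+ i / i`!%:R).
  by rewrite expr_div_n mulrA mulrCA mulfV ?mulr1// expf_neq0.
have -> : expR (- x) = expR (- (x / 2)) * expR (- (x / 2)).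
  by rewrite -expRD; congr expR; lra.
rewrite [leLHS](_ : _ = (expR (- (x / 2)) * 2 ^+ i) *
    ((x / 2) ^+ i / i`!%:R * expR (- (x / 2)))); last by rewrite mulrCA mulrAC mulrA; ring.
rewrite -[leRHS]mulr1 ler_wpM2l ?mulr_ge0 ?expR_ge0 ?exprn_ge0//.
by rewrite expRN ler_pdivrMr ?expR_gt0// mul1r.
Qed.

Lemma greedy_directionP (q : int -> option nat) (x : int) (e : bool) :
  greedy_direction q x e = 1 \/ greedy_direction q x e = -1.
Proof.
rewrite /greedy_direction; case: ifP => _; first by left.
case: ifP => _; first by right.
by case: e; [left|right].
Qed.

Definition max_neighbor (q : int -> option nat) (x : int) : nat :=
  maxn (odflt 0%N (q (x - 1))) (odflt 0%N (q (x + 1))).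

Lemma greedy_direction_max (q : int -> option nat) (x : int) (e : bool) :
  odflt 0%N (q (x + greedy_direction q x e)) = max_neighbor q x.
Proof.
rewrite /greedy_direction /max_neighbor.
set r := odflt 0%N (q (x + 1)); set l := odflt 0%N (q (x - 1)).
case: (ltngtP l r) => [lr|rl|lr].
- by [].
- by [].
- by case: e; rewrite -/r -/l lr.
Qed.

Section transition.
Context (R : realType) (lambda : R) (lambda_gt0 : 0 < lambda).
Context (zeta : nat -> probability R R).

(** Law of the duration of a step that empties a queue which held [k] customers
    before the travel time. *)
Definition duration_prob (k : nat) (B : set R) : \bar R :=
  (\int[poisson_prob lambda 0%N]_j
     zeta (k + j)%N [set z | B (1 + z)%R])%E.

Lemma measurable_add1 (B : set R) : measurable B ->
  measurable [set z : R | B (1 + z)].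
Proof.
move=> mB; rewrite -[X in measurable X]setTI.
by apply: (measurable_funD (measurable_cst (1 : R)) (@measurable_id _ R setT)).
Qed.

Lemma duration_prob_ge0 k B : (0 <= duration_prob k B)%E.
Proof. by apply: integral_ge0 => j _; exact: measure_ge0. Qed.

Lemma duration_prob_le1 k B : measurable B -> (duration_prob k B <= 1)%E.
Proof.
move=> mB; rewrite -[leRHS](_ : (\int[poisson_prob lambda 0%N]_j 1 = 1)%E).
  by apply: ge0_le_integral => // j _; apply: probability_le1; exact: measurable_add1.
by rewrite integral_cst// mul1e; exact: probability_setT.
Qed.

Lemma greedy_transition0 q x t e (B : set R) (v : int -> option nat) :
  measurable B ->
  greedy_transition lambda zeta q x t e B fset0 v =
  duration_prob (max_neighbor q x) B.
Proof.
move=> mB; rewrite /greedy_transition /duration_prob greedy_direction_max.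
apply: eq_integral => j _.
under eq_integral do rewrite big_seq_fset0 mule1.
by rewrite -(setIT [set z | B (1 + z)]) -integral_indic//; exact: measurable_add1.
Qed.

Lemma greedy_transition_server q x t e (B : set R) (v : int -> option nat) :
  measurable B -> v (x + greedy_direction q x e) = Some 0%N ->
  greedy_transition lambda zeta q x t e B
    [fset (x + greedy_direction q x e)%R]%fset v =
  duration_prob (max_neighbor q x) B.
Proof.
move=> mB vy; rewrite -(greedy_transition0 q x t e v mB) /greedy_transition.
apply: eq_integral => j _; apply: eq_integral => z _.
by rewrite big_seq_fset0 big_seq_fset1 /queue_pmf eqxx vy eqxx.
Qed.

(** A bound for the probability that a Poisson variable of mean at least
    [lambda * s] takes the value [v]; it vanishes for the symbol of a queue not
    yet inspected. *)
Definition poisson_bound (s : R) (v : option nat) : R :=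
  if v is Some i then expR (- (lambda * s / 2)) * 2 ^+ i else 0.

Lemma poisson_bound_ge0 s v : 0 <= poisson_bound s v.
Proof. by case: v => //= i; rewrite mulr_ge0 ?expR_ge0// exprn_ge0. Qed.

(** Probability that the duration lies in [B] and that the queue which the server
    has just left, and which was empty, then has the value [v]. *)
Definition left_queue_prob (k : nat) (B : set R) (v : option nat) : \bar R :=
  (\int[poisson_prob lambda 0%N]_j \int[zeta (k + j)%N]_z
     ((\1_B (1 + z)%R)%:E *
      poisson_prob (lambda * (1 + z)) 0%N [set i | Some i = v]))%E.

(** The queue just left is always an inspected one, so the kernel does not involve
    the time here. *)
Lemma greedy_transition_left q x t e B (v : int -> option nat) :
  q x = Some 0%N ->
  greedy_transition lambda zeta q x t e B [fset x]%fset v =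
  left_queue_prob (max_neighbor q x) B (v x).
Proof.
move=> qx.
have xy : (x == x + greedy_direction q x e) = false.
  by have [->|->] := greedy_directionP q x e; apply/eqP; lia.
rewrite /greedy_transition greedy_direction_max.
apply: eq_integral => j _; apply: eq_integral => z _.
by rewrite big_seq_fset1 /queue_pmf xy qx.
Qed.

Lemma left_queue_prob_le (k : nat) (B : set R) (s : R) (v : option nat) :
  measurable B -> 0 < s -> B `<=` [set r | s <= r] ->
  (left_queue_prob k B v <= (poisson_bound s v)%:E * duration_prob k B)%E.
Proof.
move=> mB s0 Bs.
pose g (v : option nat) z : R := if v is Some i then poisson_pmf (lambda * (1 + z)) i else 0.
have transE : left_queue_prob k B v =
    (\int[poisson_prob lambda 0%N]_j \int[zeta (k + j)%N]_z
      (\1_B (1 + z)%R * g v z)%:E)%E.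
  apply: eq_integral => j _; apply: eq_integral => z _.
  rewrite EFinM indicE.
  case: (boolP (1 + z \in B)) => [|_]; last by rewrite !mul0e.
  rewrite inE => /Bs /= sz; congr (_ * _)%E.
  rewrite /g /poisson_prob; have -> : 0 < lambda * (1 + z) by rewrite mulr_gt0//; lra.
  case: v => [i|]; last by rewrite (_ : [set j | _] = set0) ?esum_set0//; apply/seteqP; split.
  rewrite (_ : [set j | _] = [set i]) ?esum_set1 ?lee_fin ?poisson_pmf_ge0//.
  by apply/seteqP; split => l /= => [[]|->].
have mg u : measurable_fun setT (g u).
  case: u => [i|]; last exact: measurable_cst.
  apply: (measurableT_comp (measurable_poisson_pmf i measurableT)).
  by apply: measurable_funM => //; exact: measurable_funD.
have m1 : measurable_fun setT (fun z : R => \1_B (1 + z) : R).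
  apply: measurableT_comp; first exact: measurable_indic.
  exact: measurable_funD.
have g0 u z : 0 <= g u z by case: u => [i|] //; exact: poisson_pmf_ge0.
rewrite transE /duration_prob -ge0_integralZl//; last first.
  by rewrite lee_fin poisson_bound_ge0.
apply: ge0_le_integral => //.
- by move=> j _; apply: integral_ge0 => z _; rewrite lee_fin mulr_ge0.
move=> j _.
rewrite -(setIT [set z | B (1 + z)]) -integral_indic//; last exact: measurable_add1.
rewrite -ge0_integralZl//; last 2 first.
- apply/measurable_EFinP; apply: measurable_indic; exact: measurable_add1.
- by rewrite lee_fin poisson_bound_ge0.
apply: ge0_le_integral => //.
- by move=> z _; rewrite lee_fin mulr_ge0.
- by apply/measurable_EFinP/measurable_funM.
- apply: emeasurable_funM => //.
  apply/measurable_EFinP; apply: measurable_indic; exact: measurable_add1.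
move=> z _; rewrite -EFinM lee_fin !indicE.
have -> : (z \in [set z | B (1 + z)]) = (1 + z \in B) by apply/idP/idP; rewrite !inE.
case: (boolP (1 + z \in B)) => [|_]; last by rewrite mul0r mulr0.
rewrite inE => /Bs /= sz; rewrite mul1r mulr1.
case: {transE} v => //= i.
apply: (le_trans (poisson_pmf_le _ _)); first by rewrite mulr_gt0//; lra.
by rewrite ler_wpM2r ?exprn_ge0// ler_expR lerN2 ler_pM2r ?invr_gt0// ler_pM2l.
Qed.

End transition.

(** * One step of the greedy server *)

Section greedy_process.
Context (R : realType) (lambda : R) (lambda_gt0 : 0 < lambda).
Context (zeta : nat -> probability R R).
Context (d : measure_display) (Omega : measurableType d) (P : probability Omega R).
Context (Q : nat -> Omega -> int -> option nat) (X : nat -> Omega -> int).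
Context (T tau : nat -> {RV P >-> R}) (xi : nat -> {RV P >-> bool}).
Hypothesis PsiP : greedy_server lambda zeta Q X T tau xi.

(** The position and the two neighbouring queues determine the next move and the
    law of its duration. On such an event the conditional probabilities used
    below are constants, so integrating them over the history is immediate. *)
Definition local_event (n : nat) (x : int) (a b : option nat) : set Omega :=
  [set w | X n w = x] `&` [set w | Q n w (x - 1) = a] `&`
  [set w | Q n w (x + 1) = b].

Let step_event n (H : set Omega) e B (F : {fset int}) v :=
  H `&` [set w | [/\ xi n w = e, B (tau n.+1 w) &
                     forall k, k \in F -> Q n.+1 w k = v k]].

Let history n := <<s greedy_history Q X T xi n >>.

Let history_measurable n H : history n H -> measurable H.
Proof.
apply: smallest_sub; first exact: sigma_algebra_measurable.
move=> A [[[|]|]|].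
- by move=> [m [k [v [_ ->]]]]; exact: (greedy_measurableQ PsiP).
- by move=> [m [x [_ ->]]]; exact: (greedy_measurableX PsiP).
- move=> [m [B [_ mB ->]]]; rewrite -[X in measurable X]setTI.
  exact: measurable_funP.
- move=> [m [e [_ ->]]].
  rewrite (_ : [set w | _] = xi m @^-1` [set e])//.
  by rewrite -[X in measurable X]setTI; exact: measurable_funP.
Qed.

Let history_setI n A B : history n A -> history n B -> history n (A `&` B).
Proof. exact: (@measurableI _ (g_sigma_algebraType (greedy_history Q X T xi n))). Qed.

Let history_Q n k v : history n [set w | Q n w k = v].
Proof. by apply: sub_gen_smallest; left; left; left; exists n, k, v. Qed.

Let history_X n x : history n [set w | X n w = x].
Proof. by apply: sub_gen_smallest; left; left; right; exists n, x. Qed.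

Let history_local n x a b : history n (local_event n x a b).
Proof.
by apply: history_setI => //; apply: history_setI => //; exact: history_X.
Qed.

Let measurable_tie n e : measurable [set w | xi n w = e].
Proof.
rewrite (_ : [set w | _] = xi n @^-1` [set e])//.
by rewrite -[X in measurable X]setTI; exact: measurable_funP.
Qed.

Let measurable_tau n B : measurable B -> measurable [set w | B (tau n w)].
Proof. by move=> mB; rewrite -[X in measurable X]setTI; exact: measurable_funP. Qed.

Let measurable_step n H e B (F : {fset int}) v : measurable H -> measurable B ->
  measurable (step_event n H e B F v).
Proof.
move=> mH mB; apply: measurableI => //.
rewrite (_ : [set w | _] = [set w | xi n w = e] `&` [set w | B (tau n.+1 w)] `&`
   \bigcap_(k in [set` F]) [set w | Q n.+1 w k = v k]).
  apply: measurableI; first by apply: measurableI; [|exact: measurable_tau].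
  by apply: fin_bigcap_measurable => // k _; exact: (greedy_measurableQ PsiP).
by apply/seteqP; split => w /=; [move=> [xe Bt Qv] | move=> [[xe Bt] Qv]].
Qed.

Let step_prob n (H : set Omega) x a b e B (F : {fset int}) v (p : \bar R) :
  history n H -> measurable B -> H `<=` local_event n x a b ->
  (forall w, H w ->
    greedy_transition lambda zeta (Q n w) x (T n w) e B F v = p) ->
  P (step_event n H e B F v) = ((2^-1)%:E * p * P H)%E.
Proof.
move=> hH mB Hloc Hp; rewrite /step_event (greedy_step PsiP)//.
rewrite -integral_cst; last exact: history_measurable hH.
apply: eq_integral => w; rewrite inE => Hw.
by have [[/= -> _] _] := Hloc _ Hw; rewrite Hp.
Qed.

Let max_neighborE n x a b w : local_event n x a b w ->
  max_neighbor (Q n w) x = maxn (odflt 0%N a) (odflt 0%N b).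
Proof. by move=> [[/= _ <-] <-]. Qed.

Let kap (a b : option nat) := maxn (odflt 0%N a) (odflt 0%N b).

Let step_duration n (H : set Omega) x a b e B :
  history n H -> measurable B -> H `<=` local_event n x a b ->
  P (H `&` [set w | xi n w = e /\ B (tau n.+1 w)]) =
  ((2^-1)%:E * duration_prob lambda zeta (kap a b) B * P H)%E.
Proof.
move=> hH mB Hloc.
rewrite -(@step_prob n H x a b e B fset0 (fun=> None))//.
  congr (P _); apply/seteqP; split => w /=.
    by move=> [Hw [xe Bt]]; split.
  by move=> [Hw [xe Bt _]]; split.
by move=> w Hw; rewrite greedy_transition0// (max_neighborE (Hloc _ Hw)).
Qed.

Let duration_setT k : duration_prob lambda zeta k setT = 1%E.
Proof.
rewrite /duration_prob.
under eq_integral do rewrite (_ : [set z | _] = setT) ?probability_setT//.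
by rewrite integral_cst// mul1e; exact: probability_setT.
Qed.

Let tie_setT n (H : set Omega) x a b e : history n H ->
  H `<=` local_event n x a b ->
  P (H `&` [set w | xi n w = e]) = ((2^-1)%:E * P H)%E.
Proof.
move=> hH Hloc; have := @step_duration n H x a b e setT hH measurableT Hloc.
rewrite duration_setT mule1 => <-; congr (P _).
by apply/seteqP; split => w /= [Hw]; [|case].
Qed.

Let split_tie n (A : set Omega) : measurable A ->
  P A = (P (A `&` [set w | xi n w = true]) + P (A `&` [set w | xi n w = false]))%E.
Proof.
move=> mA; rewrite -measureU; first 1 last.
- exact: measurableI.
- exact: measurableI.
- by apply/seteqP; split => w //= [[_ ->] []].
rewrite -setIUr; congr (P _); apply/seteqP; split => w /=; last by case.
by move=> Aw; split=> //; case: (xi n w); [left|right].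
Qed.

Let step_durationT n (H : set Omega) x a b B :
  history n H -> measurable B -> H `<=` local_event n x a b ->
  P (H `&` [set w | B (tau n.+1 w)]) =
  (duration_prob lambda zeta (kap a b) B * P H)%E.
Proof.
move=> hH mB Hloc; rewrite (@split_tie n); last first.
  by apply: measurableI; [exact: history_measurable hH|exact: measurable_tau].
have splitE e : P (H `&` [set w | B (tau n.+1 w)] `&` [set w | xi n w = e]) =
    ((2^-1)%:E * duration_prob lambda zeta (kap a b) B * P H)%E.
  rewrite -(step_duration e hH mB Hloc); congr (P _).
  by apply/seteqP; split => w /= => [[[]]|[? []]].
rewrite !splitE -!muleA -ge0_muleDl ?lee_fin// -EFinD.
by rewrite (_ : 2^-1 + 2^-1 = 1) ?mul1e//; lra.
Qed.

Let step_left n (H : set Omega) x a b (s : R) B v :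
  history n H -> measurable B -> H `<=` local_event n x a b ->
  H `<=` [set w | Q n w x = Some 0%N] -> 0 < s -> B `<=` [set r | s <= r] ->
  (P (H `&` [set w | B (tau n.+1 w) /\ Q n.+1 w x = v]) <=
   (poisson_bound lambda s v)%:E * P (H `&` [set w | B (tau n.+1 w)]))%E.
Proof.
move=> hH mB Hloc Hx s0 Bs.
have mH := history_measurable hH.
have mBQ : measurable [set w | B (tau n.+1 w) /\ Q n.+1 w x = v].
  by apply: measurableI; [exact: measurable_tau|exact: (greedy_measurableQ PsiP)].
have mB' : measurable [set w | B (tau n.+1 w)] by exact: measurable_tau.
have c0 := poisson_bound_ge0 lambda s v.
rewrite (@split_tie n); last exact: measurableI.
rewrite (@split_tie n (H `&` [set w | B _])); last exact: measurableI.
rewrite ge0_muleDr//.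
suff tie e : (P (H `&` [set w | B (tau n.+1 w) /\ Q n.+1 w x = v] `&` [set w | xi n w = e]) <=
   (poisson_bound lambda s v)%:E *
     P (H `&` [set w | B (tau n.+1 w)] `&` [set w | xi n w = e]))%E.
  by apply: leeD.
have -> : H `&` [set w | B (tau n.+1 w)] `&` [set w | xi n w = e] =
    H `&` [set w | xi n w = e /\ B (tau n.+1 w)].
  by apply/seteqP; split => w /= => [[[]]|[? []]].
rewrite (step_duration e hH mB Hloc).
have -> : H `&` [set w | B (tau n.+1 w) /\ Q n.+1 w x = v] `&` [set w | xi n w = e] =
    step_event n H e B [fset x]%fset (fun=> v).
  apply/seteqP; split => w /=.
    by move=> [[Hw [Bt Qv]] xe]; split => //; split => // k; rewrite inE => /eqP ->.
  by move=> [Hw [xe Bt Qv]]; split => //; split => //; split => //; apply: Qv; rewrite inE.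
rewrite (@step_prob n H x a b e B _ _ (left_queue_prob lambda zeta (kap a b) B v))//; last first.
  by move=> w Hw; rewrite greedy_transition_left ?(max_neighborE (Hloc _ Hw))//; exact: Hx.
rewrite muleA; apply: lee_wpmul2r => //.
rewrite muleCA; apply: lee_wpmul2l; first by rewrite lee_fin.
exact: left_queue_prob_le.
Qed.

Definition neighbor_max n w := max_neighbor (Q n w) (X n w).

Lemma measurable_neighbor_max n k : measurable [set w | neighbor_max n w = k].
Proof.
pose J : countType := (int * option nat * option nat)%type.
rewrite (_ : [set w | _] = \bigcup_(j : J)
    (if kap j.1.2 j.2 == k then local_event n j.1.1 j.1.2 j.2 else set0)).
  apply: countable_bigcupT_measurable => // j; case: ifP => // _.
  exact: history_measurable (@history_local n j.1.1 j.1.2 j.2).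
apply/seteqP; split => w /=.
  move=> <-; exists (X n w, Q n w (X n w - 1), Q n w (X n w + 1)) => //=.
  by rewrite eqxx.
move=> [[[x a] b] _ /=]; case: eqP => // <- wl.
by have [[/= xw _] _] := wl; rewrite /neighbor_max xw (max_neighborE wl).
Qed.

Let local_cover n (A : set Omega) (B : set Omega) (c : R) :
  measurable A -> measurable B -> 0 <= c ->
  (forall x a b, (P (A `&` local_event n x a b) <=
     c%:E * P (B `&` local_event n x a b))%E) ->
  (P A <= c%:E * P B)%E.
Proof.
move=> mA mB c0 AB.
apply: (@le_measure_fibers _ _ _ P
  (int * option nat * option nat)%type
  (fun w => (X n w, Q n w (X n w - 1), Q n w (X n w + 1)))) => //.
  move=> [[x a] b]; rewrite (_ : [set w | _] = local_event n x a b).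
    exact: history_measurable (@history_local n x a b).
  by apply/seteqP; split => w /= => [[<- <- <-]|[[/= -> <-] <-]].
move=> [[x a] b]; rewrite (_ : [set w | _] = local_event n x a b)//.
by apply/seteqP; split => w /= => [[<- <- <-]|[[/= -> <-] <-]].
Qed.

Let measurable_server_empty n : measurable [set w | Q n w (X n w) = Some 0%N].
Proof.
rewrite (_ : [set w | _] = \bigcup_(x : int)
    ([set w | X n w = x] `&` [set w | Q n w x = Some 0%N])).
  apply: countable_bigcupT_measurable => // x; apply: measurableI.
    exact: (greedy_measurableX PsiP).
  exact: (greedy_measurableQ PsiP).
by apply/seteqP; split => w /= => [Qw|[x _ [<-]]//]; exists (X n w).
Qed.

(** The state only records this almost surely: the kernel gives probability one
    to the value [Some 0] at the queue that is emptied. *)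
Let server_empty n : P (~` [set w | Q n w (X n w) = Some 0%N]) = 0%E.
Proof.
case: n => [|n].
  rewrite (_ : ~` _ = set0) ?measure0//; apply/seteqP; split => w //=.
  by rewrite (greedy_X0 PsiP) (greedy_Q0 PsiP) normr0.
have mA : measurable (~` [set w | Q n.+1 w (X n.+1 w) = Some 0%N]).
  exact: measurableC.
apply/eqP; rewrite eq_le measure_ge0 andbT -(mul0e (P setT)).
apply: (@local_cover n) => // x a b; rewrite setTI mul0e.
have hL := @history_local n x a b; have mL := history_measurable hL.
rewrite (@split_tie n); last exact: measurableI.
suff tie e : P (~` [set w | Q n.+1 w (X n.+1 w) = Some 0%N] `&` local_event n x a b
    `&` [set w | xi n w = e]) = 0%E by rewrite !tie adde0.
(* A fixed configuration with the same neighbours yields the same move. *)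
pose q0 k := if k == x + 1 then b else a.
pose y := x + greedy_direction q0 x e.
have yE w : local_event n x a b w -> x + greedy_direction (Q n w) x e = y.
  move=> [[/= _ Qa] Qb]; rewrite /y /greedy_direction Qa Qb /q0 eqxx.
  by have -> : (x - 1 == x + 1) = false by apply/eqP; lia.
pose E := step_event n (local_event n x a b) e setT [fset y]%fset (fun=> Some 0%N).
pose D := local_event n x a b `&` [set w | xi n w = e].
have mD : measurable D by exact: measurableI.
have mE : measurable E by exact: measurable_step.
have ED : E `<=` D by move=> w [Lw [/= xe _ _]].
have PE : P E = P D.
  rewrite /E (@step_prob n _ x a b _ _ _ _ 1%E)//; last first.
    move=> w Lw; rewrite -(yE w Lw) greedy_transition_server ?duration_setT//.
  by rewrite mule1 /D (@tie_setT n _ x a b).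
apply: (@subset_measure0 _ _ _ P _ (D `\` E)).
- by apply: measurableI => //; exact: measurableI.
- exact: measurableD.
- move=> w [[/= Q0 Lw] xe]; split; first by split.
  move=> [_ [_ _ Qy]]; apply: Q0; rewrite (greedy_XS PsiP) xe.
  have [[/= -> _] _] := Lw; rewrite (yE w Lw).
  by apply: Qy; rewrite inE.
- rewrite measureD//; last by rewrite ltey_eq fin_num_measure.
  rewrite (setIidr ED) [X in (X - _)%E](_ : _ = P E)// subee// fin_num_measure//.
Qed.

Let next_max_ge n w : (odflt 0%N (Q n.+1 w (X n w)) <= neighbor_max n.+1 w)%N.
Proof.
rewrite /neighbor_max /max_neighbor (greedy_XS PsiP) leq_max.
have [->|->] := greedy_directionP (Q n w) (X n w) (xi n w).
  by rewrite addrK leqnn.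
by rewrite subrK leqnn orbT.
Qed.

Lemma measurable_bad_step n k (f : nat) :
  measurable [set w | (neighbor_max n.+1 w < f)%N \/ (tau n.+1 w < k%:R)%R].
Proof.
apply: (@measurableU _ _ [set w | (neighbor_max n.+1 w < f)%N]
    [set w | tau n.+1 w < k%:R]).
  rewrite (_ : [set w | _] = \bigcup_(i in `I_f) [set w | neighbor_max n.+1 w = i]).
    by apply: bigcup_measurable => i _; exact: measurable_neighbor_max.
  apply/seteqP; split => w /=; first by move=> wf; exists (neighbor_max n.+1 w).
  by move=> [i /= ilt ->].
rewrite (_ : [set w | _] = tau n.+1 @^-1` `]-oo, k%:R[).
  by rewrite -[X in measurable X]setTI; exact: measurable_funP.
by apply/seteqP; split => w /=; rewrite in_itv.
Qed.

(** The queue just left is next to the new position of the server and receives a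
    Poisson number of customers of mean [lambda] times the duration. So either
    the duration is less than [s], with probability [p], or a Poisson variable
    of mean at least [lambda * s] is less than [f], where the bounds
    [poisson_bound] for its values sum up to at most
    [expR (- (lambda * s / 2)) * 2 ^+ f]. *)
Lemma neighbor_max_step n k (f : nat) (s : R) (p : R) :
  0 < s -> k%:R <= s ->
  duration_prob lambda zeta k [set r | r < s] = p%:E ->
  (P ([set w | neighbor_max n w = k] `&`
      [set w | (neighbor_max n.+1 w < f)%N \/ (tau n.+1 w < k%:R)%R]) <=
   (p + expR (- (lambda * s / 2)) * 2 ^+ f * (1 - p))%:E *
     P [set w | neighbor_max n w = k])%E.
Proof.
move=> s0 ks pE; set C := _ * 2 ^+ f.
have mlt := measurable_lt_set s.
have mge : measurable [set r : R | s <= r].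
  rewrite (_ : [set r | _] = `[s, +oo[%classic)//.
  by apply/seteqP; split => r /=; rewrite in_itv/= andbT.
have p0 : 0 <= p by rewrite -lee_fin -pE duration_prob_ge0.
have p1 : p <= 1 by rewrite -lee_fin -pE duration_prob_le1.
have C0 : 0 <= C by rewrite mulr_ge0 ?expR_ge0// exprn_ge0.
have c0 : 0 <= p + C * (1 - p) by rewrite addr_ge0// mulr_ge0// subr_ge0.
have mk := measurable_neighbor_max n k.
have mbad := measurable_bad_step n k f.
apply: (@local_cover n) => //; first exact: measurableI.
move=> x a b; have hL := @history_local n x a b; have mL := history_measurable hL.
have [abk|abk] := eqVneq (kap a b) k; last first.
  rewrite (_ : _ `&` _ `&` local_event n x a b = set0).
    by rewrite measure0 mule_ge0// lee_fin.
  apply/seteqP; split => // w [[/= wk _] Lw]; exfalso; move/eqP: abk; apply.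
  by rewrite -wk /neighbor_max; have [[/= -> _] _] := Lw; rewrite (max_neighborE Lw).
pose H := local_event n x a b `&` [set w | Q n w x = Some 0%N].
have hH : history n H by apply: history_setI => //; exact: history_Q.
have mH := history_measurable hH.
have HL : H `<=` local_event n x a b by move=> w [].
have HQ : H `<=` [set w | Q n w x = Some 0%N] by move=> w [].
pose Hs := H `&` [set w | tau n.+1 w < s].
pose Hg := H `&` [set w | s <= tau n.+1 w].
have mHs : measurable Hs by apply: measurableI => //; exact: (@measurable_tau n.+1 _ mlt).
have mHg : measurable Hg by apply: measurableI => //; exact: (@measurable_tau n.+1 _ mge).
have PHs : P Hs = (p%:E * P H)%E.
  by rewrite -pE -abk; exact: (@step_durationT n H x a b _ hH mlt HL).
have PHsg : (P Hs + P Hg = P H)%E.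
  rewrite -measureU//.
    rewrite -setIUr; congr (P _); apply/seteqP; split => w /=; first by case.
    by move=> Hw; split => //; case: (ltP (tau n.+1 w) s); [left|right].
  by apply/seteqP; split => w //= [[_ ws] [_]]; rewrite /= leNgt ws.
pose v (i : nat) := if i is j.+1 then Some j else None.
pose G i := H `&` [set w | s <= tau n.+1 w /\ Q n.+1 w x = v i].
have mG i : measurable (G i).
  apply: measurableI => //; apply: measurableI; last exact: (greedy_measurableQ PsiP).
  exact: (@measurable_tau n.+1 _ mge).
pose N := ~` [set w | Q n w (X n w) = Some 0%N].
have mN : measurable N by apply: measurableC; exact: measurable_server_empty.
have mGU : measurable (\big[setU/set0]_(i < f.+1) G i) by exact: bigsetU_measurable.
have sub : [set w | neighbor_max n w = k] `&`
      [set w | (neighbor_max n.+1 w < f)%N \/ (tau n.+1 w < k%:R)%R] `&`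
      local_event n x a b `<=` (Hs `|` \big[setU/set0]_(i < f.+1) G i) `|` N.
  move=> w [[/= wk wbad] Lw].
  have [[/= wx _] _] := Lw.
  have [Q0|NQ] := pselect (Q n w (X n w) = Some 0%N); last by right.
  rewrite wx in Q0; have Hw : H w by [].
  left; have [ws|sw] := ltP (tau n.+1 w) s; first by left.
  right; case: wbad => [nf|]; last by rewrite ltNge (le_trans ks).
  rewrite -bigcup_mkord; have := leq_ltn_trans (next_max_ge n w) nf; rewrite wx.
  case Qv : (Q n.+1 w x) => [j|] /= jf.
    by exists j.+1 => //=; split.
  by exists 0%N => //=; split.
apply: le_trans (le_measure P _ _ sub) _; rewrite ?inE//.
- by apply: measurableI => //; exact: measurableI.
- by apply: measurableU => //; exact: measurableU.
apply: le_trans (measureU2 _ _ _) _ => //; first exact: measurableU.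
rewrite [X in (_ + X <= _)%E](server_empty n) adde0.
apply: le_trans (measureU2 _ _ _) _ => //.
have PG : (P (\big[setU/set0]_(i < f.+1) G i) <= C%:E * P Hg)%E.
  apply: le_trans (Boole_inequality _ _) _ => //.
  apply: (@le_trans _ _ (\sum_(i < f.+1) (poisson_bound lambda s (v i))%:E * P Hg)%E).
    by apply: lee_sum => i _; exact: (@step_left n H x a b s _ (v i) hH mge HL HQ s0).
  rewrite -ge0_sume_distrl; last by move=> i _; rewrite lee_fin poisson_bound_ge0.
  rewrite lee_wpmul2r// sumEFin lee_fin big_ord_recl /= add0r -mulr_sumr.
  rewrite ler_wpM2l ?expR_ge0//.
  elim: (f) => [|m IH]; first by rewrite big_ord0.
  by rewrite big_ord_recr/= exprS; lra.
apply: (@le_trans _ _ (P Hs + C%:E * P Hg)%E); first by rewrite leeD2l.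
apply: (@le_trans _ _ ((p + C * (1 - p))%:E * P H)%E); last first.
  rewrite lee_wpmul2l ?lee_fin//; apply: le_measure; rewrite ?inE//.
    exact: measurableI.
  move=> w [Lw _]; split => //=; rewrite -abk /neighbor_max.
  by have [[/= -> _] _] := Lw; rewrite (max_neighborE Lw).
move: PHs PHsg.
rewrite -(fineK (fin_num_measure P _ mH)) -(fineK (fin_num_measure P _ mHs)).
rewrite -(fineK (fin_num_measure P _ mHg)) -!EFinM -!EFinD => -[-> []].
move: (fine (P H)) (fine (P Hg)) => h g hg; rewrite lee_fin -hg; nra.
Qed.

Lemma tau_ge1 n : (forall k, zeta k `]-oo, 0[%classic = 0%E) ->
  {ae P, forall w, 1 <= tau n.+1 w}.
Proof.
move=> zeta0.
have mlt := measurable_lt_set (1 : R).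
have mA : measurable [set w | tau n.+1 w < 1] by exact: (@measurable_tau n.+1 _ mlt).
exists [set w | tau n.+1 w < 1]; split => //; last first.
  by move=> w /= /negP; rewrite -ltNge.
apply/eqP; rewrite eq_le measure_ge0 andbT -(mul0e (P setT)).
apply: (@local_cover n) => // x a b; rewrite mul0e setIC.
rewrite (@step_durationT n _ x a b _ (@history_local n x a b) mlt)//.
rewrite [X in (X * _)%E](_ : _ = 0%E) ?mul0e// /duration_prob.
under eq_integral.
  move=> j _; rewrite (_ : [set z | _] = `]-oo, 0[%classic) ?zeta0; last first.
    by apply/seteqP; split => z /=; rewrite in_itv/= gtrDl.
  over.
by rewrite integral_cst// mul0e.
Qed.

End greedy_process.

(** * Superpolynomial decay *)

Lemma expR_half_le (R : realType) (u : R) : 0 <= u -> u <= 1 ->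
  expR (u / 2) <= 1 + u.
Proof.
move=> u0 u1; have := expR_ge1Dx (- (u / 2)); rewrite expRN => h.
have e0 := expR_gt0 (u / 2).
rewrite -(@ler_pM2l _ (1 - u / 2)); last by lra.
apply: (@le_trans _ _ 1); last by nra.
by rewrite -ler_pdivlMr// mul1r.
Qed.

(** [(1 + k ^ (- beta / 2)) ^ k] is at least [expR (k ^ (1 - beta / 2) / 2)],
    which exceeds every power of [k] because [beta < 2]. *)
Lemma polynomial_mul_decay (R : realType) (c beta : R) : 0 <= c ->
  0 <= beta -> beta < 2 ->
  exists M : nat, forall k : nat, (M <= k)%N ->
    c * k%:R `^ beta * (1 + k%:R `^ (- (beta / 2))) ^- k <= (2 * k%:R)^-1.
Proof.
move=> c0 b0 b2.
have g0 : 0 < 1 - beta / 2 by lra.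
pose p := Num.trunc ((beta + 2) / (1 - beta / 2)).
have pP : beta + 2 <= (1 - beta / 2) * p.+1%:R.
  have /truncn_itv/andP[_ /ltW] : 0 <= (beta + 2) / (1 - beta / 2).
    by rewrite divr_ge0//; lra.
  by rewrite ler_pdivrMr// mulrC.
pose D : R := 2 ^+ p.+1 * (p.+1)`!%:R.
have D0 : 0 < D by rewrite mulr_gt0// ltr0n fact_gt0.
exists (Num.trunc (2 * c * D)).+1 => k Mk.
have cDk : 2 * c * D <= k%:R.
  have /truncn_itv/andP[_ /ltW/le_trans] : 0 <= 2 * c * D.
    by rewrite mulr_ge0 ?mulr_ge0// ltW.
  by apply; rewrite ler_nat.
set x : R := k%:R; set u := x `^ (- (beta / 2)).
have x1 : 1 <= x by rewrite /x ler1n (leq_trans _ Mk).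
have x0 : 0 < x by lra.
have u0 : 0 <= u by exact: powR_ge0.
have u1 : u <= 1 by rewrite -[leRHS](powRr0 x) ler_powR//; lra.
have ux : u * x = x `^ (1 - beta / 2).
  rewrite powRD; last by rewrite (gt_eqF x0) implybT.
  by rewrite powRr1 ?(ltW x0)// mulrC.
have lower : x `^ (beta + 2) / D <= (1 + u) ^+ k.
  apply: (@le_trans _ _ (expR (u / 2) ^+ k)); last first.
    by rewrite lerXn2r ?nnegrE ?expR_ge0//; [lra|exact: expR_half_le].
  rewrite -expRM_natl.
  have -> : k%:R * (u / 2) = x `^ (1 - beta / 2) / 2 by rewrite -ux /x; lra.
  set y := x `^ (1 - beta / 2) / 2.
  have y0 : 0 <= y by rewrite divr_ge0// powR_ge0.
  apply: (@le_trans _ _ (y ^+ p.+1 / (p.+1)`!%:R)); last first.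
    by apply: le_trans (expR_ge1Dxn p y0); rewrite lerDr.
  rewrite /D invfM mulrA ler_pM2r ?invr_gt0 ?ltr0n ?fact_gt0//.
  rewrite /y expr_div_n ler_pM2r ?invr_gt0 ?exprn_gt0//.
  by rewrite -powR_mulrn ?powR_ge0// -powRrM ler_powR.
have xb0 : 0 < x `^ (beta + 2) by rewrite powR_gt0.
apply: (@le_trans _ _ (c * x `^ beta * (D / x `^ (beta + 2)))).
  rewrite ler_wpM2l ?mulr_ge0 ?powR_ge0//.
  by rewrite -invf_div lef_pV2// posrE ?divr_gt0// exprn_gt0//; lra.
rewrite powRD ?(gt_eqF x0) ?implybT// powR_mulrn ?(ltW x0)//.
have xb : 0 < x `^ beta by rewrite powR_gt0.
rewrite [leLHS](_ : _ = (c * D) / x ^+ 2); last first.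
  by field; rewrite !gt_eqF.
rewrite ler_pdivrMr ?exprn_gt0// [leRHS](_ : _ = x / 2); last first.
  by field; rewrite gt_eqF.
by rewrite -/x in cDk; lra.
Qed.

(** * Duration of a step *)

Section duration_bounds.
Context (R : realType) (lambda : R) (lambda_gt0 : 0 < lambda).
Context (zeta : nat -> probability R R).
Hypothesis zetaP : forall k, is_mm1_emptying_law lambda lambda k (zeta k).

Let short_emptying k j u s : (0 < k)%N -> 0 < u -> u <= 2^-1 ->
  (zeta (k + j)%N [set z | (1 + z < s)%R] <=
   (expR (4 * u ^+ 2 * lambda * s) * (4 / u ^+ 2) * (1 + u) ^- k)%:E)%E.
Proof.
move=> k0 u0 u2.
apply: (@le_trans _ _ (zeta (k + j)%N `]-oo, s[%classic)).
  apply: le_measure; rewrite ?inE//.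
    exact: measurable_add1 (measurable_lt_set s).
  by move=> z /=; rewrite in_itv/= => zs; lra.
have kj : (0 < k + j)%N by rewrite addn_gt0 k0.
apply: le_trans (mm1_emptying_law_tail s lambda_gt0 (zetaP (k + j)%N) kj u0 u2) _.
rewrite lee_fin ler_wpM2l//.
  by rewrite mulr_ge0 ?expR_ge0// divr_ge0// sqr_ge0.
rewrite lef_pV2 ?posrE ?exprn_gt0//; try lra.
by rewrite ler_weXn2l ?leq_addr//; lra.
Qed.

(** Arrivals during the travel only decrease the bound for the time to empty. *)
Lemma duration_tail k u s : (0 < k)%N -> 0 < u -> u <= 2^-1 ->
  (duration_prob lambda zeta k [set r | (r < s)%R] <=
   (expR (4 * u ^+ 2 * lambda * s) * (4 / u ^+ 2) * (1 + u) ^- k)%:E)%E.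
Proof.
move=> k0 u0 u2; set b := _ * _ * _.
rewrite -[leRHS](_ : (\int[poisson_prob lambda 0%N]_j b%:E = b%:E)%E); last first.
  rewrite integral_cst// [X in (_ * X)%E](_ : _ = 1%E) ?mule1//.
  exact: probability_setT.
by apply: ge0_le_integral => // j _; exact: short_emptying.
Qed.

(** With positive probability, so many customers arrive during the travel that the
    step lasts at least [s] with probability at least one half, whatever the
    state was. *)
Lemma duration_nondegenerate (s : R) : exists2 delta : R, 0 < delta &
  forall k, (duration_prob lambda zeta k [set r | (r < s)%R] <= (1 - delta)%:E)%E.
Proof.
pose b (K : nat) := expR (4 * 2^-1 ^+ 2 * lambda * s) * (4 / 2^-1 ^+ 2) *
  (1 + 2^-1) ^- K.
have [K K0 bK] : exists2 K, (0 < K)%N & b K <= 2^-1.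
  have : b K @[K --> \oo] --> (0 : R).
    rewrite /b -[X in _ --> X](mulr0 (expR (4 * 2^-1 ^+ 2 * lambda * s) * (4 / 2^-1 ^+ 2))).
    apply: cvgMr; under eq_fun do rewrite -exprVn.
    by apply: cvg_expr; rewrite ger0_norm ?invr_ge0 ?invf_lt1; lra.
  move=> /cvgrPdist_le /(_ 2^-1); rewrite invr_gt0 ltr0n => /(_ isT) [K _ Kb].
  exists K.+1 => //; have := Kb K.+1 (leqnSn K); rewrite sub0r normrN.
  by apply: le_trans; exact: ler_norm.
pose a := poisson_pmf lambda K.
have a0 : 0 < a.
  by rewrite /a /poisson_pmf lambda_gt0 mulr_gt0 ?expR_gt0// divr_gt0 ?exprn_gt0 ?ltr0n ?fact_gt0.
exists (a / 2) => [|k]; first by rewrite divr_gt0.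
apply: (@le_trans _ _ (\int[poisson_prob lambda 0%N]_j
    ((\1_(~` [set K]) j)%:E + (2^-1)%:E * (\1_[set K] j)%:E))%E).
  apply: ge0_le_integral => // j _; rewrite !indicE in_setC -EFinM -EFinD; case: (boolP (j \in [set K])) => jK.
    move: jK; rewrite inE => /= ->; rewrite /= mulr1n mulr1 add0r addnC.
    have h0 : 0 < 2^-1 :> R by rewrite invr_gt0.
    by apply: le_trans (@short_emptying K k _ s K0 h0 (lexx _)) _; rewrite lee_fin.
  rewrite mulr0 addr0 mulr1n; apply: probability_le1.
  exact: measurable_add1 (measurable_lt_set s).
rewrite ge0_integralD//=.
rewrite ge0_integralZl//= !integral_indic// !setIT.
have PK : poisson_prob lambda 0%N [set K] = a%:E.
  by rewrite /poisson_prob lambda_gt0 esum_set1// lee_fin poisson_pmf_ge0.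
have PC : poisson_prob lambda 0%N (~` [set K]) = (1 - a%:E)%E.
  by rewrite -PK; exact: probability_setC.
rewrite [X in (X + _)%E]PC [X in (_ + _ * X)%E]PK -EFinM -EFinB -EFinD lee_fin; lra.
Qed.

End duration_bounds.

(** * Thresholds for the growth of the queues *)

Lemma powR_iterate_ge (R : realType) (beta : R) (kappa : nat -> nat) (n0 : nat) :
  0 <= beta -> expR 1 <= (kappa n0)%:R :> R ->
  (forall n, (n0 <= n)%N -> (kappa n)%:R `^ beta <= (kappa n.+1)%:R) ->
  forall m, expR (beta ^+ m) <= (kappa (n0 + m)%N)%:R.
Proof.
move=> b0 k1 kS; elim=> [|m IH]; first by rewrite expr0 addn0.
rewrite addnS; apply: le_trans (kS _ (leq_addr _ _)).
rewrite exprSr expRM; apply: ge0_ler_powR => //; rewrite nnegrE ?expR_ge0//.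
Qed.

Lemma expr_ratio_near (R : realType) (alpha beta : R) (j : nat) :
  0 < alpha -> alpha < beta ->
  \forall m \near \oo, alpha ^+ (m + j) <= beta ^+ m.
Proof.
move=> a0 ab; have b0 : 0 < beta by lra.
have : (alpha / beta) ^+ m @[m --> \oo] --> (0 : R).
  by apply: cvg_expr; rewrite ger0_norm ?divr_ge0 ?(ltW a0) ?(ltW b0)// ltr_pdivrMr// mul1r.
move=> /cvgrPdist_le /(_ (alpha ^- j)); rewrite invr_gt0 exprn_gt0// => /(_ isT).
apply: filterS => m; rewrite sub0r normrN => /(le_trans (ler_norm _)).
rewrite expr_div_n ler_pdivrMr ?exprn_gt0// mulrC ler_pdivlMr ?exprn_gt0//.
by rewrite exprD.
Qed.

Section growth_threshold.
Context (R : realType) (lambda beta : R) (lambda_gt0 : 0 < lambda).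
Hypotheses (beta_gt1 : 1 < beta) (beta_lt2 : beta < 2).
Variable M : nat.

(** A step from level [k] counts as good only if the next level reaches
    [threshold k]: then it exceeds [M], doubles [k] and is at least
    [k ^ beta]. *)
Definition threshold (k : nat) : nat :=
  (M + 2 * k + (Num.trunc (k%:R `^ beta : R)).+1)%N.

(** During a step of this duration, the mean number of arrivals at a queue is at
    least four times the threshold; the first term makes the duration at least
    [k]. *)
Definition min_duration (k : nat) : R := k%:R + 4 * (threshold k)%:R / lambda.

Lemma threshold_ge_powR k : k%:R `^ beta <= (threshold k)%:R.
Proof.
have /truncn_itv/andP[_ /ltW/le_trans] := powR_ge0 (k%:R : R) beta; apply.
by rewrite ler_nat leq_addl.
Qed.

Lemma threshold_le k : (M <= k)%N -> (0 < k)%N ->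
  (threshold k)%:R <= 5 * k%:R `^ beta.
Proof.
move=> Mk k0; have /truncn_itv/andP[tr _] := powR_ge0 (k%:R : R) beta.
have k1 : 1 <= k%:R :> R by rewrite ler1n.
have kb : k%:R <= k%:R `^ beta by rewrite le1r_powR// ltW.
have Mk' : M%:R <= k%:R :> R by rewrite ler_nat.
by rewrite /threshold 2!natrD natrM -natr1; lra.
Qed.

Lemma min_duration_le k : (M <= k)%N -> (0 < k)%N ->
  lambda * min_duration k <= (lambda + 20) * k%:R `^ beta.
Proof.
move=> Mk k0; have := threshold_le Mk k0.
have k1 : 1 <= k%:R :> R by rewrite ler1n.
have kb : k%:R <= k%:R `^ beta by rewrite le1r_powR// ltW.
have -> : lambda * min_duration k = lambda * k%:R + 4 * (threshold k)%:R.
  by rewrite /min_duration; field; rewrite gt_eqF.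
have : lambda * k%:R <= lambda * k%:R `^ beta by rewrite ler_pM2l.
by lra.
Qed.

Lemma poisson_bound_threshold k :
  expR (- (lambda * min_duration k / 2)) * 2 ^+ threshold k <=
  ((threshold k).+1)%:R^-1.
Proof.
set t := (threshold k)%:R : R.
have ls : 2 * t <= lambda * min_duration k / 2.
  have -> : lambda * min_duration k / 2 = lambda * k%:R / 2 + 2 * t.
    by rewrite /min_duration -/t; field; rewrite gt_eqF.
  by rewrite lerDr divr_ge0// mulr_ge0// ltW.
have two_le : 2 ^+ threshold k <= expR t.
  rewrite -[t]mulr1 expRM_natl lerXn2r ?nnegrE ?expR_ge0//.
  by have := @expR_ge1Dx R 1; rewrite (_ : 1 + 1 = 2).
apply: (@le_trans _ _ (expR (- (2 * t)) * expR t)).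
  by apply: ler_pM; rewrite ?expR_ge0 ?exprn_ge0// ler_expR lerN2.
rewrite -expRD (_ : - (2 * t) + t = - t); last by rewrite mulr_natl mulr2n opprD subrK.
rewrite expRN lef_pV2 ?posrE ?expR_gt0 ?ltr0n//.
by rewrite -natr1 addrC; exact: expR_ge1Dx.
Qed.

End growth_threshold.

Section duration_tail_min_duration.
Context (R : realType) (lambda beta : R) (lambda_gt0 : 0 < lambda).
Context (zeta : nat -> probability R R).
Hypothesis zetaP : forall k, is_mm1_emptying_law lambda lambda k (zeta k).
Hypotheses (beta_gt1 : 1 < beta) (beta_lt2 : beta < 2).

(** The time [min_duration k] is of order [k ^ beta], much less than the order
    [k ^ 2] of the time to empty [k] customers; the tilt [u] in [duration_tail]
    is the inverse square root of [k ^ beta]. *)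
Lemma duration_tail_min_duration : exists2 M : nat, (4 <= M)%N &
  forall k, (M <= k)%N ->
    (duration_prob lambda zeta k [set r | (r < min_duration lambda beta M k)%R] <=
      ((2 * k%:R)^-1)%:E)%E.
Proof.
pose c := expR (4 * (lambda + 20)) * 4.
have c0 : 0 <= c by rewrite mulr_ge0 ?expR_ge0.
have b0 : 0 <= beta by rewrite ltW// (lt_trans ltr01).
have l0 : 0 < lambda := lambda_gt0.
have bt : 1 < beta := beta_gt1.
have [M0 M0P] := polynomial_mul_decay c0 b0 beta_lt2.
exists (maxn M0 4); first exact: leq_maxr.
move=> k; rewrite geq_max => /andP[Mk k4].
have k0 : (0 < k)%N by lia.
have x4 : 4 <= k%:R :> R by rewrite (ler_nat _ 4).
have x0 : 0 < k%:R :> R by lra.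
set u := k%:R `^ (- (beta / 2)).
have u0 : 0 < u by rewrite powR_gt0.
have u2 : u <= 2^-1.
  rewrite /u powRN lef_pV2 ?posrE ?powR_gt0//.
  apply: (@le_trans _ _ (k%:R `^ 2^-1)); last by rewrite ler_powR//; lra.
  have r0 : 0 <= k%:R `^ 2^-1 :> R by exact: powR_ge0.
  have : (k%:R `^ 2^-1) ^+ 2 = k%:R :> R.
    by rewrite -powR_mulrn// -powRrM mulVf// powRr1// ltW.
  by nra.
have uu : u ^+ 2 = (k%:R `^ beta)^-1.
  rewrite -powR_mulrn ?powR_ge0// -powRrM -powRN; congr (_ `^ _).
  by field.
have kb0 : 0 < k%:R `^ beta by rewrite powR_gt0.
apply: le_trans (duration_tail lambda_gt0 zetaP (min_duration lambda beta (maxn M0 4) k) k0 u0 u2) _.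
rewrite lee_fin uu invrK; apply: le_trans (M0P _ Mk).
rewrite -/u ler_pM2r ?invr_gt0 ?exprn_gt0//; last by lra.
rewrite mulrA ler_pM2r// /c ler_pM2r// ler_expR -!mulrA ler_pM2l// mulrC.
rewrite ler_pdivrMr//; apply: min_duration_le => //.
by rewrite geq_max Mk.
Qed.

End duration_tail_min_duration.

(** * Doubly exponential growth *)

Lemma expR1_le4 (R : realType) : expR 1 <= 4 :> R.
Proof.
have := expR_ge1Dx (- (2^-1) : R); rewrite expRN => h.
have e0 := expR_gt0 (2^-1 : R).
have h2 : expR (2^-1) <= 2 :> R.
  rewrite -[leRHS]invrK -[leLHS]invrK lef_pV2 ?posrE ?invr_gt0//; lra.
have -> : expR 1 = expR (2^-1) * expR (2^-1) :> R by rewrite -expRD; congr expR; lra.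
by nra.
Qed.

Theorem proposition4p1 (R : realType) (lambda : R) (lambda_gt0 : 0 < lambda)
    (zeta : nat -> probability R R)
    (zetaP : forall k, is_mm1_emptying_law lambda lambda k (zeta k))
    (d : measure_display) (Omega : measurableType d) (P : probability Omega R)
    (Q : nat -> Omega -> int -> option nat) (X : nat -> Omega -> int)
    (T tau : nat -> {RV P >-> R}) (xi : nat -> {RV P >-> bool})
    (PsiP : greedy_server lambda zeta Q X T tau xi)
    (alpha : R) (alpha_gt1 : 1 < alpha) (alpha_lt2 : alpha < 2) :
  {ae P, forall w, \forall n \near \oo,
    T n w >= tau n w /\ tau n w >= expR (alpha ^+ n)}.
Proof.
pose beta := (alpha + 2) / 2.
have beta_gt1 : 1 < beta by rewrite /beta; lra.
have beta_lt2 : beta < 2 by rewrite /beta; lra.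
have [M M4 MP] := duration_tail_min_duration lambda_gt0 zetaP beta_gt1 beta_lt2.
pose kappa n w := neighbor_max Q X n w.
pose thr := threshold beta M.
pose s k := min_duration lambda beta M k.
pose bad n := [set w | (kappa n.+1 w < thr (kappa n w))%N \/ tau n.+1 w < (kappa n w)%:R].
have thr_gt0 k : (0 < thr k)%N by rewrite /thr /threshold addnS.
have s_gt0 k : 0 < s k.
  by rewrite /s /min_duration ltr_wpDl// divr_gt0// mulr_gt0// ltr0n.
have sk k : k%:R <= s k.
  by rewrite /s /min_duration lerDl divr_ge0 ?(ltW lambda_gt0)// mulr_ge0.
have mlt := @measurable_lt_set R.
have dur_fin k t : duration_prob lambda zeta k [set r | (r < t)%R] \is a fin_num.
  rewrite ge0_fin_numE ?duration_prob_ge0//.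
  by apply: le_lt_trans (duration_prob_le1 _ _ _ (mlt t)) _; rewrite ltry.
have bad_cond n k : (P ([set w | kappa n w = k] `&` bad n) <=
    (fine (duration_prob lambda zeta k [set r | (r < s k)%R]) +
     ((thr k).+1)%:R^-1 *
     (1 - fine (duration_prob lambda zeta k [set r | (r < s k)%R])))%:E *
    P [set w | kappa n w = k])%E.
  set p := fine _.
  have pE : duration_prob lambda zeta k [set r | (r < s k)%R] = p%:E.
    by rewrite /p fineK.
  have p1 : p <= 1 by rewrite -lee_fin -pE; exact: duration_prob_le1.
  rewrite (_ : _ `&` bad n = [set w | kappa n w = k] `&`
      [set w | (kappa n.+1 w < thr k)%N \/ (tau n.+1 w < k%:R)%R]); last first.
    by apply/seteqP; split => w /= [<-].
  apply: le_trans (neighbor_max_step lambda_gt0 PsiP n (thr k) (s_gt0 k) (sk k) pE) _.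
  apply: lee_wpmul2r => //; rewrite lee_fin lerD2l ler_wpM2r ?subr_ge0//.
  exact: poisson_bound_threshold.
have mkappa n k : measurable [set w | kappa n w = k].
  exact: (measurable_neighbor_max PsiP).
have mbad n : measurable (bad n).
  rewrite (_ : bad n = \bigcup_k ([set w | kappa n w = k] `&`
      [set w | (kappa n.+1 w < thr k)%N \/ (tau n.+1 w < k%:R)%R])).
    by apply: bigcup_measurable => k _; apply: measurableI => //; exact: (measurable_bad_step PsiP).
  by apply/seteqP; split => w /= => [wb|[k _ [/= <-]]//]; exists (kappa n w).
(* The sum is a common bound for the durations required from levels below [M]. *)
have [delta delta0 deltaP] :=
  duration_nondegenerate lambda_gt0 zetaP (\sum_(k < M) s k).
have bad_low n k : (k < M)%N -> (P ([set w | kappa n w = k] `&` bad n) <=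
   (1 - delta / 2)%:E * P [set w | kappa n w = k])%E.
  move=> kM; apply: le_trans (bad_cond n k) _; apply: lee_wpmul2r => //.
  rewrite lee_fin; set p := fine _.
  have p_le : p <= 1 - delta.
    rewrite -lee_fin fineK ?dur_fin//; apply: le_trans (deltaP k).
    apply: ge0_le_integral => // j _; apply: le_measure; rewrite ?inE.
    - exact: measurable_add1 (mlt _).
    - exact: measurable_add1 (mlt _).
    move=> z /= /lt_le_trans; apply.
    rewrite (bigD1 (Ordinal kM))//= lerDl sumr_ge0// => i _; exact: ltW.
  have thr2 : ((thr k).+1)%:R^-1 <= 2^-1 :> R.
    by rewrite lef_pV2 ?posrE ?ltr0n// (ler_nat _ 2) ltnS.
  have p1 : 0 <= 1 - p by lra.
  by apply: le_trans (lerD (lexx p) (ler_wpM2r p1 thr2)) _; lra.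
have bad_high n k : (M <= k)%N -> (P ([set w | kappa n w = k] `&` bad n) <=
   (k%:R^-1)%:E * P [set w | kappa n w = k])%E.
  move=> Mk; apply: le_trans (bad_cond n k) _; apply: lee_wpmul2r => //.
  rewrite lee_fin; set p := fine _.
  have p0 : 0 <= p by exact/fine_ge0/duration_prob_ge0.
  have k0 : 0 < k%:R :> R by rewrite ltr0n; lia.
  have p_le : p <= (2 * k%:R)^-1 by rewrite -lee_fin fineK ?dur_fin//; exact: MP.
  have thr_le : ((thr k).+1)%:R^-1 <= (2 * k%:R)^-1 :> R.
    rewrite lef_pV2 ?posrE ?ltr0n ?mulr_gt0// -(natrM _ 2) ler_nat /thr /threshold.
    by lia.
  have inv2 : (2 * k%:R)^-1 + (2 * k%:R)^-1 = k%:R^-1 :> R.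
    by field; rewrite gt_eqF.
  rewrite -inv2 lerD// (le_trans _ thr_le)//.
  by rewrite ler_piMr ?invr_ge0// lerBlDr lerDl.
have good_grows n w : ~ bad n w -> (M <= kappa n.+1 w)%N /\ (2 * kappa n w <= kappa n.+1 w)%N.
  move=> /not_orP[/negP]; rewrite -leqNgt /thr /threshold => h _; lia.
have delta20 : 0 < delta / 2 by rewrite divr_gt0.
have good := finitely_many_bad M4 delta20 mkappa mbad bad_low bad_high good_grows.
have zeta0 k := mm1_emptying_law_ge0 (zetaP k).
have tau1 : {ae P, forall w, forall n, 1 <= tau n.+1 w}.
  by apply: ae_foralln => n; exact: (tau_ge1 PsiP n zeta0).
apply: filterS2 good tau1 => w [n0 _ good_w] tau1_w.
have T0 n : 0 <= T n w.
  elim: n => [|n IH]; first by rewrite (greedy_T0 PsiP).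
  by rewrite (greedy_TS PsiP) addr_ge0// (le_trans _ (tau1_w n)).
have next n : (n0 <= n)%N -> (thr (kappa n w) <= kappa n.+1 w)%N /\
    (kappa n w)%:R <= tau n.+1 w.
  move=> /good_w /not_orP[/negP h1 /negP h2].
  by split; [rewrite leqNgt|rewrite leNgt].
(* After one good step the level is at least [M >= 4], hence at least [expR 1]. *)
pose n1 := n0.+1.
have iter m : expR (beta ^+ m) <= (kappa (n1 + m)%N w)%:R.
  apply: (@powR_iterate_ge R beta (fun n => kappa n w)).
  - by lra.
  - have [h _] := next n0 (leqnn _).
    apply: (@le_trans _ _ 4); first exact: expR1_le4.
    by rewrite (ler_nat _ 4); apply: leq_trans h; rewrite /thr /threshold; lia.
  - move=> n nn; have [h _] := next n (ltnW nn).
    by apply: (le_trans (threshold_ge_powR beta M _)); rewrite ler_nat.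
have alpha_lt : alpha < beta by rewrite /beta; lra.
have [N _ NP] := expr_ratio_near n1.+1 (lt_trans ltr01 alpha_gt1) alpha_lt.
exists (N + n1.+1)%N => // n /= Nn.
have -> : n = (n1 + (n - n1.+1)).+1 by lia.
set m := (n - n1.+1)%N; split.
  by rewrite (greedy_TS PsiP) lerDr.
have [_] := next (n1 + m)%N (leq_trans (leqnSn _) (leq_addr _ _)).
apply: le_trans; apply: le_trans (iter m); rewrite ler_expR.
have := NP m; rewrite addnS addnC; apply; rewrite /= /m; lia.
Qed.
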